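(* Let $Y$ be an infinite connected general graph, with underlying simple graph $\overline Y$. Then $D_L(Y)\le\deg\overline Y$ and, if $Y$ is repetitive, $D_{RL}(Y)\le\deg\overline Y$.
   Context: A general graph $Y$ is a countable graph with finite vertex degrees which may have loops, multiple edges and a partial direction (some of the edges are directed). $\overline Y$ is the undirected simple graph with the same vertex set, obtained by forgetting directions and loops and putting a single edge between every pair of distinct adjacent vertices of $Y$. $\deg\overline Y\in\mathbb{Z}^+\cup\{\infty\}$ is the supremum of the vertex degrees of $\overline Y$. $Y$ is connected if $\overline Y$ is connected; then its vertex set has the metric $d$ given by minimal path length in $\overline Y$, and $D_Y(y,R)$ is the closed disk of radius $R$, with the induced general graph structure. Isomorphisms (and automorphisms) of general graphs are bijections $f$ between vertex sets such that, for all vertices $u,v$, the number of undirected edges between $u$ and $v$ and the number of directed edges from $u$ to $v$ equal the corresponding numbers for $f(u),f(v)$ (including loops, $u=v$). A (vertex) coloring by $n$ colors is a map from the vertex set to $\{0,\dots,n-1\}$; isomorphisms of pointed colored general graphs preserve base points and colors. For connected colored general graphs, $(Z,\psi)$ with a base point $z$ is a limit of $(Y,\phi)$ if for every $R\in\mathbb{Z}^+$ there is a vertex $y$ of $Y$ with $(D_Y(y,R),y,\phi)\cong(D_Z(z,R),z,\psi)$. $(Y,\phi)$ is aperiodic if its only color-preserving automorphism is the identity; limit aperiodic if all of its limits are aperiodic; and repetitive if there are a vertex $p$ and $R_i\uparrow\infty$ in $\mathbb{Z}^+$ such that, for every $i$, the set of vertices $y$ with $(D_Y(y,R_i),y,\phi)\cong(D_Y(p,R_i),p,\phi)$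 is relatively dense (every vertex is at bounded distance from it). $Y$ is repetitive if the same holds with the colorings omitted. $D_L(Y)$ is the infimum of the $n\in\mathbb{Z}^+$ such that $Y$ has a limit aperiodic coloring by $n$ colors; for $Y$ repetitive, $D_{RL}(Y)$ is the infimum of the $n\in\mathbb{Z}^+$ such that $Y$ has a repetitive limit aperiodic coloring by $n$ colors ($\inf\emptyset=\infty$). *)

(* Defs.v *)
From mathcomp Require Import all_boot all_order all_algebra finmap.
From mathcomp Require Import boolp classical_sets functions cardinality.
From mathcomp Require Import constructive_ereal.

Set Implicit Arguments.
Unset Strict Implicit.
Unset Printing Implicit Defensive.

Import Order.TTheory GRing.Theory Num.Theory.

Local Open Scope classical_set_scope.

(* Suprema and infima of sets of natural numbers, taken in the ordered set of
   integers with infinities: nat_inf set0 = +oo, and nat_sup A = +oo when A is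
   unbounded. *)
Section ExtendedNat.
Implicit Types A : set nat.

Definition nat_sup A : \bar int :=
  supremum -oo%E [set (Posz n)%:E%E | n in A].

Definition nat_inf A : \bar int :=
  infimum +oo%E [set (Posz n)%:E%E | n in A].

Lemma nat_inf0 : nat_inf set0 = +oo%E.
Proof. by rewrite /nat_inf image_set0 /infimum eqxx. Qed.

Lemma nat_inf_min A n :
  A n -> (forall m, A m -> n <= m) -> nat_inf A = (Posz n)%:E%E.
Proof.
move=> An min_n; rewrite /nat_inf /infimum ifF; last first.
  by apply/eqP => A0; have : set0 (Posz n)%:E%E by rewrite -A0; exists n.
have inf_n : infimums [set (Posz m)%:E%E | m in A] (Posz n)%:E%E.
  split; first by move=> _ [m Am <-]; rewrite lee_fin lez_nat min_n.
  by move=> y; apply; exists n.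
by case: xgetP => [_ -> h|/(_ _ inf_n)//]; exact: is_subset1_infimums h inf_n.
Qed.

Lemma nat_inf_le A n : A n -> (nat_inf A <= (Posz n)%:E)%E.
Proof.
move=> An; have exA : exists m, `[< A m >] by exists n; apply/asboolP.
case: (ex_minnP exA) => m /asboolP Am min_m.
rewrite (@nat_inf_min _ m) //; last by move=> k Ak; apply/min_m/asboolP.
by rewrite lee_fin lez_nat; apply/min_m/asboolP.
Qed.

Lemma nat_sup_max A n :
  A n -> (forall m, A m -> m <= n) -> nat_sup A = (Posz n)%:E%E.
Proof.
move=> An max_n; rewrite /nat_sup /supremum ifF; last first.
  by apply/eqP => A0; have : set0 (Posz n)%:E%E by rewrite -A0; exists n.
have sup_n : supremums [set (Posz m)%:E%E | m in A] (Posz n)%:E%E.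
  split; first by move=> _ [m Am <-]; rewrite lee_fin lez_nat max_n.
  by move=> y; apply; exists n.
by case: xgetP => [_ -> h|/(_ _ sup_n)//]; exact: is_subset1_supremums h sup_n.
Qed.

Lemma nat_sup_unbounded A :
  (forall m, exists2 n, A n & m <= n) -> nat_sup A = +oo%E.
Proof.
move=> unbA; rewrite /nat_sup /supremum ifF; last first.
  have [n An _] := unbA 0.
  by apply/eqP => A0; have : set0 (Posz n)%:E%E by rewrite -A0; exists n.
have sup_oo : supremums [set (Posz m)%:E%E | m in A] +oo%E.
  split; first by move=> _ [m _ <-]; rewrite leey.
  move=> [z| |] ub //.
    have [n An lt_n] := unbA `|z|.+1.
    have : ((Posz n)%:E <= z%:E)%E by apply: ub; exists n.
    rewrite lee_fin => /le_trans /(_ (lez_abs z)); rewrite lez_nat.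
    by move=> /(leq_trans lt_n); rewrite ltnn.
  have [n An _] := unbA 0.
  have : ((Posz n)%:E <= -oo)%E by apply: ub; exists n.
  by rewrite leeNy_eq.
by case: xgetP => [_ -> h|/(_ _ sup_oo)//]; exact: is_subset1_supremums h sup_oo.
Qed.

End ExtendedNat.

(* [uedges u v] is the number of undirected edges between u and v, and
   [dedges u v] the number of directed edges from u to v; u = v counts loops.
   Isomorphisms only see these numbers. *)
Record ggraph := GGraph {
  vertex :> countType;
  uedges : vertex -> vertex -> nat;
  dedges : vertex -> vertex -> nat;
  uedges_sym : forall u v, uedges u v = uedges v u;
  finite_degrees : forall u,
    finite_set [set v | 0 < uedges u v + dedges u v + dedges v u]
}.

Section GeneralGraph.
Variable Y : ggraph.
Implicit Types (u v y : Y) (R n : nat).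

(* The edge relation of the underlying simple graph. *)
Definition adj : rel Y :=
  fun u v => (u != v) && (0 < uedges u v + dedges u v + dedges v u).

Lemma adj_irr : irreflexive adj.
Proof. by move=> u; rewrite /adj eqxx. Qed.

Lemma adj_sym : symmetric adj.
Proof. by move=> u v; rewrite /adj eq_sym uedges_sym addnAC. Qed.

Lemma finite_adj u : finite_set [set v | adj u v].
Proof.
by apply: sub_finite_set (finite_degrees u) => v /= /andP[].
Qed.

Definition degree u : nat := #|` fset_set [set v | adj u v]|.

Definition max_degree : \bar int :=
  nat_sup [set degree u | u in [set: Y]].

Definition walk u v n : Prop :=
  exists s : seq Y, [/\ path adj u s, last u s = v & size s = n].

Definition connected_graph : Prop := forall u v, exists n, walk u v n.

(* The junk value 0 only occurs for vertices in distinct components. *)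
Definition dist u v : nat :=
  if pselect (exists n, `[< walk u v n >]) is left ex then ex_minn ex else 0.

Lemma dist_leP u v R : connected_graph ->
  reflect (exists2 n, n <= R & walk u v n) (dist u v <= R).
Proof.
move=> conn; rewrite /dist; case: pselect => [ex|nex]; last first.
  by case: nex; have [n w] := conn u v; exists n; apply/asboolP.
case: ex_minnP => m /asboolP w min_m; apply: (iffP idP) => [le_m|[n le_n wn]].
  by exists m.
by apply: leq_trans le_n; apply: min_m; apply/asboolP.
Qed.

Lemma dist0 u : dist u u = 0.
Proof.
rewrite /dist; case: pselect => // ex; case: ex_minnP => m _ min_m.
by apply/eqP; rewrite -leqn0; apply: min_m; apply/asboolP; exists [::].
Qed.

Section Induced.
Variable A : pred Y.

Lemma induced_finite_degrees (u : {v | A v}) :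
  finite_set [set v : {v | A v} |
    0 < uedges (val u) (val v) + dedges (val u) (val v) +
        dedges (val v) (val u)].
Proof.
apply: (@finite_preimage _ _
  [set w | 0 < uedges (val u) w + dedges (val u) w + dedges w (val u)]).
  by move=> x y _ _; exact: val_inj.
exact: finite_degrees.
Qed.

Definition induced : ggraph :=
  @GGraph {v | A v}
    (fun p q => uedges (val p) (val q)) (fun p q => dedges (val p) (val q))
    (fun p q => uedges_sym (val p) (val q)) induced_finite_degrees.

End Induced.

Definition disk y R : ggraph := induced (fun v => dist y v <= R).

Lemma center_subproof y R : dist y y <= R.
Proof. by rewrite dist0. Qed.

Definition center y R : disk y R :=
  exist (fun v : Y => dist y v <= R) y (center_subproof y R).

Definition disk_incl y R : disk y R -> Y := fun p => val p.

Definition relatively_dense (A : set Y) : Prop :=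
  exists C : nat, forall v, exists2 a, A a & dist v a <= C.

End GeneralGraph.

Definition graph_iso (Y Z : ggraph) (f : Y -> Z) : Prop :=
  [/\ bijective f,
      forall u v, uedges (f u) (f v) = uedges u v &
      forall u v, dedges (f u) (f v) = dedges u v].

Definition disk_equiv (Y Z : ggraph) (y : Y) (z : Z) (R : nat) : Prop :=
  exists f : disk y R -> disk z R, graph_iso f /\ f (center y R) = center z R.

Definition increasing_to_infinity (r : nat -> nat) : Prop :=
  {homo r : i j / i <= j} /\ forall M, exists i, M <= r i.

Definition repetitive (Y : ggraph) : Prop :=
  exists (p : Y) (r : nat -> nat),
    [/\ increasing_to_infinity r, forall i, 0 < r i &
        forall i, @relatively_dense Y [set y : Y | disk_equiv y p (r i)]].

Section Colorings.
Variable T : Type.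

Definition colored_disk_equiv (Y : ggraph) (phi : Y -> T)
    (Z : ggraph) (psi : Z -> T) (y : Y) (z : Z) (R : nat) : Prop :=
  exists f : disk y R -> disk z R,
    [/\ graph_iso f, f (center y R) = center z R &
        forall v, psi (disk_incl (f v)) = phi (disk_incl v)].

Definition is_limit (Y : ggraph) (phi : Y -> T)
    (Z : ggraph) (psi : Z -> T) (z : Z) : Prop :=
  forall R, 0 < R -> exists y : Y, colored_disk_equiv phi psi y z R.

Definition aperiodic (Y : ggraph) (phi : Y -> T) : Prop :=
  forall f : Y -> Y, graph_iso f -> (forall v, phi (f v) = phi v) ->
  forall v, f v = v.

Definition limit_aperiodic (Y : ggraph) (phi : Y -> T) : Prop :=
  forall (Z : ggraph) (psi : Z -> T) (z : Z),
    connected_graph Z -> is_limit phi psi z -> aperiodic psi.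

Definition repetitive_coloring (Y : ggraph) (phi : Y -> T) : Prop :=
  exists (p : Y) (r : nat -> nat),
    [/\ increasing_to_infinity r, forall i, 0 < r i &
        forall i,
          @relatively_dense Y [set y : Y | colored_disk_equiv phi phi y p (r i)]].

End Colorings.

Definition D_L (Y : ggraph) : \bar int :=
  nat_inf [set n | 0 < n /\ exists phi : Y -> 'I_n, limit_aperiodic phi].

(* Meant for repetitive Y only. *)
Definition D_RL (Y : ggraph) : \bar int :=
  nat_inf [set n | 0 < n /\ exists phi : Y -> 'I_n,
    repetitive_coloring phi /\ limit_aperiodic phi].

(* Main.v *)
Require Import Defs.
From mathcomp Require Import all_boot all_order all_algebra finmap.
From mathcomp Require Import boolp classical_sets functions cardinality.
From mathcomp Require Import constructive_ereal filter zify.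
Set Implicit Arguments.
Unset Strict Implicit.
Unset Printing Implicit Defensive.

Import Order.TTheory GRing.Theory Num.Theory.
Local Open Scope nat_scope.

(** Let Delta be the largest degree of the underlying simple graph; if the
    degrees are unbounded, both bounds are +oo.  Everything rests on a coloring
    psi by Delta colors with a uniform local property: for every D there is an
    R such that two distinct vertices at distance at most D never have
    isomorphic colored R-disks ([locally_distinguishing_coloring]).  An
    automorphism of a limit of (Y, psi) that moves a vertex by D would be
    visible in Y on arbitrarily large disks, so psi is limit aperiodic
    ([locally_distinguishing_limit_aperiodic]).

    To build psi, choose sparse roots and a breadth-first forest grown from
    them.  A vertex that is not a root has at most Delta - 1 children, so
    siblings can get distinct nonzero colors; the color 0 is left to mark the
    roots and to write bits, one child per family at most being affected.  A
    color-preserving isomorphism of disks then respects roots and levels, and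
    if it fixes all lower neighbors of v it fixes v, whose image is a sibling
    of v with the same color ([chi_determined]).  So it only matters what
    happens to the roots.

    A first family of bits, written in the slots around each root, makes the
    disks of nearby roots of the same kind nonisomorphic
    ([slot_bits_separate]).  Suppose that two isomorphisms agree at w.  The
    roots to which a neighbor of w descends are then sent to nearby roots with
    isomorphic disks, hence to the same roots, and climbing back up the forest
    shows that the isomorphisms agree at that neighbor: the coloring is rigid
    ([separates_rigid]).

    The difficulty is capacity.  A root has to be told apart from as many
    competitors as there are vertices in a disk of comparable radius, possibly
    exponentially many, but a disk that looks like a path holds only linearly
    many bits.  Hence two kinds of roots.  The large disk around a thin root
    has fewer than 2^m vertices, so linearly many bits in a smaller disk
    suffice; the large disk around a thick root has at least 2^m vertices, and
    so has room for exponentially many bits, while the competitors number only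
    2^O(m).  The choice of scales in [nets_exist] makes both inequalities hold.

    By rigidity an isomorphism of disks is determined by the image of one
    vertex, so for each D few isomorphisms displace a given vertex by at most
    D.  A second family of bits, one beacon per root, is chosen so as to break
    all of them, for all D at once, with the same thin/thick dichotomy at every
    scale ([toggles_break_displacements]).  Both families of bits exist by a
    local lemma, proved by counting ([local_lemma]): the number of good
    assignments grows by a factor at least 3/2 with each new vertex.

    If Y is repetitive, order the colorings of Y by inclusion of their sets of
    finite patterns.  Everything below psi is limit aperiodic, and compactness
    with the lemma of Zorn gives a minimal coloring below psi
    ([minimal_coloring]).  If it were not repetitive, some pattern would be
    missing from arbitrarily large disks; since Y is repetitive, copies of
    these disks can be moved to one place, and their limit would be a strictly
    smaller coloring ([minimal_repetitive]). *)

(** * Compactness and counting *)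

Lemma ultra_finite_color (I : Type) (T : finType) (G : set_system I)
    (c : I -> T) :
  UltraFilter G -> exists t, G [set i | c i = t]%classic.
Proof.
move=> UG; apply: contrapT => nex.
have nG t : G [set i | c i <> t]%classic.
  case: (in_ultra_setVsetC [set i | c i = t]%classic UG) => // Gt.
  by case: nex; exists t.
have [i /(_ (c i))] : exists i, forall t, c i <> t.
  have := filter_ex (F := G); apply.
  exact: filter_forall.
by [].
Qed.

(** Colorings by finitely many colors converge along an ultrafilter, which
    picks one color at each vertex; on finitely many vertices the limit agrees
    with members of the family taken from any prescribed set of the filter. *)
Lemma compactness (Y : eqType) (I : Type) (T : finType) (F : set_system I)
    (g : I -> Y -> T) :
  ProperFilter F ->
  exists h : Y -> T, forall (s : seq Y) (P : set I), F P ->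
    exists2 i, P i & {in s, g i =1 h}.
Proof.
move=> PF; have [G [UG FG]] := ultraFilterLemma PF.
have /choice [h hG] v := ultra_finite_color (g^~ v) UG.
exists h => s P FP.
suff : G (P `&` [set i | {in s, g i =1 h}])%classic.
  by move=> /filter_ex [i [Pi gi]]; exists i.
elim: s => [|v s IHs].
  by apply: filterS (FG _ FP) => i Pi; split.
apply: filterS (filterI IHs (hG v)) => i [[Pi gi] giv]; split=> // w.
by rewrite inE => /predU1P[->|/gi].
Qed.

Lemma exp2_dominates p q : exists m, p * m + q <= 2 ^ m.
Proof.
have sq m : 4 <= m -> m ^ 2 <= 2 ^ m.
  elim: m => // m IHm; rewrite leq_eqVlt => /predU1P[<- //|]; rewrite ltnS => m4.
  have := IHm m4; rewrite (expnS 2 m); nia.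
exists (p + q + 4); apply: leq_trans (sq _ _); last by lia.
by nia.
Qed.

(** Greedy choice: picking s excludes at most two other points, the image and
    the preimage of s.  This turns a map that moves every point into a set of
    points disjoint from its image, on which bits can be chosen independently
    of the bits that they are compared with. *)
Lemma far_apart_third (Y : choiceType) (f : Y -> Y) (Q : {fset Y}) :
    {in Q &, injective f} -> {in Q, forall s, f s != s} ->
  exists S : {fset Y}, [/\ (S `<=` Q)%fset, #|` Q| <= 3 * #|` S| &
    {in S &, forall s s', f s != s'}].
Proof.
have [n le_n] := ubnP #|` Q|; elim: n Q le_n => // n IHn Q le_n injf nfix.
have [->|[s sQ]] := fset_0Vmem Q.
  by exists fset0; rewrite fsub0set cardfs0; split=> // s; rewrite inE.
pose Q' := [fset q in Q | (q != s) && (q != f s) && (f q != s)]%fset.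
have subQ : (Q' `<=` Q)%fset by exact: fset_sub.
have sQ' : s \notin Q' by rewrite !inE eqxx andbF.
have ltQ : #|` Q'| < #|` Q|.
  rewrite (cardfsD1 s Q) sQ add1n ltnS fsubset_leq_card //.
  by apply/fsubsetP => q qQ'; rewrite !inE (fsubsetP subQ) // andbT; apply: contraNneq sQ' => <-.
have [|q q' qQ q'Q|q qQ|S [SQ leS indS]] := IHn Q'.
- exact: leq_trans ltQ _.
- by apply: injf; apply: (fsubsetP subQ).
- by apply: nfix; apply: (fsubsetP subQ).
have sS : s \notin S by apply: contra sQ'; apply: (fsubsetP SQ).
exists (s |` S)%fset; split.
- by rewrite fsubUset fsub1set sQ (fsubset_trans SQ).
- rewrite cardfsU1 sS mulnDr muln1; apply: leq_trans (_ : 3 + #|` Q'| <= _); last first.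
    by rewrite leq_add2l.
  pose K := [fset q in Q | f q == s]%fset.
  have K1 : #|` K| <= 1.
    apply: contraT; rewrite -ltnNge => K2.
    have [k kK] : exists k, k \in K.
      by have [K0|[k kK]] := fset_0Vmem K; [move: K2; rewrite K0 cardfs0|exists k].
    have [k' /fsetD1P[nk k'K]] : exists k', k' \in (K `\ k)%fset.
      have [K0|[k' kK']] := fset_0Vmem (K `\ k)%fset; last by exists k'.
      by move: K2; rewrite (cardfsD1 k) kK K0 cardfs0.
    move: kK k'K; rewrite !inE /= => /andP[kQ /eqP fk] /andP[k'Q /eqP fk'].
    by rewrite (injf k' k) ?eqxx // ?fk in nk.
  have sub : (Q `<=` Q' `|` (K `|` [fset s; f s]))%fset.
    apply/fsubsetP => q qQ; rewrite !inE qQ /=.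
    by case: (q == s); case: (q == f s); case: (f q == s).
  apply: leq_trans (fsubset_leq_card sub) _.
  have cU (A B : {fset Y}) : #|` (A `|` B)%fset| <= #|` A| + #|` B|.
    by have := cardfsUI A B; lia.
  have := cU Q' (K `|` [fset s; f s])%fset; have := cU K [fset s; f s]%fset.
  have := cU [fset s]%fset [fset f s]%fset; rewrite !cardfs1.
  lia.
- have SQ'' q : q \in S -> [&& q \in Q, q != s, q != f s & f q != s].
    by move=> /(fsubsetP SQ); rewrite !inE -!andbA.
  move=> q q'; rewrite !inE => /predU1P[->|qS] /predU1P[->|q'S].
  + exact: nfix.
  + by rewrite eq_sym; case/and4P: (SQ'' _ q'S).
  + by case/and4P: (SQ'' _ qS).
  + exact: indS.
Qed.

Lemma leq_card_bigfcup (Y : choiceType) (I : eqType) (l : seq I)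
    (A : I -> {fset Y}) :
  #|` (\bigcup_(i <- l) A i)%fset| <= \sum_(i <- l) #|` A i|.
Proof.
elim: l => [|i l IHl]; first by rewrite !big_nil cardfs0.
rewrite !big_cons; have := cardfsUI (A i) (\bigcup_(j <- l) A j)%fset; lia.
Qed.

(** The extra factor 2^(k+2) makes the classes of bad events, indexed by k, sum
    to at most g (1/4 + 1/8 + ...). *)
Lemma geometric_half (g K : nat) (N : nat -> nat) :
  (forall k, 2 ^ (k + 2) * N k <= g) -> 2 * (\sum_(k < K) N k) <= g.
Proof.
move=> Ng.
suff : 2 ^ K.+1 * (\sum_(k < K) N k) + g <= 2 ^ K * g.
  rewrite expnS => le_g; rewrite -(leq_pmul2l (m := 2 ^ K)) ?expn_gt0 //.
  lia.
elim: K => [|K IHK]; first by rewrite big_ord0 muln0 mul1n.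
rewrite big_ord_recr /=; have := Ng K; rewrite addn2 !expnS.
move: IHK; rewrite !expnS.
move: (\sum_(_ < _) _) (N K) (2 ^ K) => s n p; nia.
Qed.

Lemma in_fset_sep (T : choiceType) (A : {fset T}) (P : pred T) x :
  (x \in [fset y in A | P y]%fset) = (x \in A) && P x.
Proof. by rewrite !inE. Qed.

Lemma card_fset_inj (T T' : choiceType) (f : T -> T') (A : {fset T}) :
  {in A &, injective f} -> #|` [fset f x | x in A]%fset| = #|` A|.
Proof. by move=> injf; rewrite card_in_imfset. Qed.

(** This is (9/8)^e >= 1 in disguise: (3/2)^k beats 2^e as soon as k >= 2e. *)
Lemma exp2_exp3 e k : 2 * e <= k -> 2 ^ e * 2 ^ k <= 3 ^ k.
Proof.
move=> le_k; move: (subnKC le_k); set d := k - 2 * e => <-.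
have le_exp p q n : p <= q -> p ^ n <= q ^ n.
  by case: n => // n; rewrite leq_exp2r.
rewrite !(expnD _ (2 * e)) !(expnM _ 2 e) mulnA -expnMn; apply: leq_mul; exact: le_exp.
Qed.

(** * A local lemma for bits *)

(** The bad events E concern finitely many bits, and in a bad assignment the
    bits on S E are determined by the others, so that being bad has probability
    at most 2^-|S E|.  The events come in classes: at most 2^(c k) events of
    class k involve a given vertex, and [large] makes each of them so unlikely
    that the classes sum up geometrically.  An assignment on F is encoded as
    the subset of F where the bit is 1. *)
Section LocalLemma.
Variables (Y I : choiceType) (supp S : I -> {fset Y}).
Variables (bad : I -> (Y -> bool) -> Prop) (cls : I -> nat) (c : nat -> nat).
Hypothesis supp_neq0 : forall E, supp E != fset0.
Hypothesis sub_supp : forall E, (S E `<=` supp E)%fset.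
Hypothesis bad_local : forall E x x', {in supp E, x =1 x'} -> bad E x -> bad E x'.
Hypothesis bad_det : forall E x x', bad E x -> bad E x' ->
  (forall v, v \notin S E -> x v = x' v) -> {in S E, x =1 x'}.
Hypothesis large : forall E, 1 + 2 * (c (cls E) + cls E + 3) <= #|` S E|.
Hypothesis few : forall v k (l : seq I), uniq l ->
  (forall E, E \in l -> cls E = k /\ v \in supp E) -> size l <= 2 ^ c k.

Definition good (F : {fset Y}) : {fset {fset Y}} :=
  locked [fset x in fpowerset F |
    `[< forall E, (supp E `<=` F)%fset -> ~ bad E (fun v => v \in x) >]]%fset.

Lemma goodP F x : reflect ((x `<=` F)%fset /\
    forall E, (supp E `<=` F)%fset -> ~ bad E (fun v => v \in x)) (x \in good F).
Proof.
rewrite /good -lock !inE /= fpowersetE; apply: (iffP andP) => -[xF].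
  by move/asboolP.
by move=> ?; split=> //; apply/asboolP.
Qed.

Definition extensions F v : {fset {fset Y}} :=
  locked [fset x in fpowerset (v |` F) | (x `\ v)%fset \in good F]%fset.

Lemma extensionsP F v x :
  reflect ((x `<=` v |` F)%fset /\ (x `\ v)%fset \in good F) (x \in extensions F v).
Proof. by rewrite /extensions -lock in_fset_sep fpowersetE; apply: (iffP andP). Qed.

Lemma card_extensions F v : v \notin F -> #|` extensions F v| = 2 * #|` good F|.
Proof.
move=> vF.
have vx x : x \in good F -> v \notin x.
  by move=> /goodP[xF _]; apply: contra vF; apply: (fsubsetP xF).
have -> : extensions F v = (good F `|` [fset (v |` x)%fset | x in good F])%fset.
  apply/fsetP => x; rewrite [RHS]in_fsetU; apply/extensionsP/orP => [[xF gx]|].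
    have [vx'|vx'] := boolP (v \in x).
      by right; apply/imfsetP; exists (x `\ v)%fset => //=; rewrite fsetD1K.
    by left; rewrite -(mem_fsetD1 vx').
  case=> [gx|/imfsetP[y /= gy ->]].
    rewrite mem_fsetD1 ?vx //; split=> //.
    by apply: fsubset_trans (fsubsetU1 _ _); case/goodP: gx.
  rewrite fsetU1K ?vx //; split=> //.
  by apply: fsetUS; case/goodP: gy.
have dis : (good F `&` [fset (v |` x)%fset | x in good F] = fset0)%fset.
  apply/fsetP => x; rewrite [RHS]inE inE; apply/andP => -[/vx vx'].
  by move=> /imfsetP[y _ xE]; rewrite xE fset1U1 in vx'.
rewrite -[LHS]addn0 -[in X in _ + X](cardfs0 {fset Y}) -dis cardfsUI.
rewrite card_fset_inj ?mul2n ?addnn // => x y /vx vx' /vx vy' /(congr1 (fun z => z `\ v)%fset).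
by rewrite !fsetU1K.
Qed.

(** Restoring the vertices of T one at a time multiplies the number of good
    assignments by at least 3/2 each time. *)
Lemma drop_good n :
  (forall F v, #|` F| < n -> v \notin F ->
     3 * #|` good F| <= 2 * #|` good (v |` F)%fset|) ->
  forall (T F : {fset Y}), #|` F| <= n ->
  3 ^ #|` (F `&` T)%fset| * #|` good (F `\` T)%fset| <=
  2 ^ #|` (F `&` T)%fset| * #|` good F|.
Proof.
move=> IH T F; have [k le_k] := ubnP #|` F|.
elim: k F le_k => // k IHk F le_k le_n.
have [FT0|[v]] := fset_0Vmem (F `&` T)%fset.
  by rewrite FT0 cardfs0 !mul1n; move/eqP: FT0 => /fsetDidPl ->.
rewrite inE => /andP[vF vT].
have ltF : #|` (F `\ v)%fset| < #|` F| by rewrite (cardfsD1 v F) vF.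
have lt1 : #|` (F `\ v)%fset| < n by apply: leq_trans ltF _.
have := IHk (F `\ v)%fset (leq_trans ltF _) (ltnW lt1).
have := IH _ v lt1; rewrite fsetD1K // !inE eqxx => /(_ isT).
have -> : ((F `\ v) `\` T = F `\` T)%fset.
  by apply/fsetP => w; rewrite !inE; case: eqP => [->|//]; rewrite vT.
rewrite (cardfsD1 v (F `&` T)%fset) !inE vF vT /=.
have -> : ((F `&` T) `\ v = (F `\ v) `&` T)%fset.
  by apply/fsetP => w; rewrite !inE andbA.
move=> h1 /(_ le_k) h2; rewrite !expnS; nia.
Qed.

(** Forgetting the bits on S E is injective on the assignments that are bad for
    E, and lands in the extensions of good assignments on the rest of F.  There
    are few of those by [drop_good]. *)
Lemma few_bad F v E : v \notin F -> (supp E `<=` v |` F)%fset ->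
  (forall F0 v, #|` F0| < #|` F| -> v \notin F0 ->
     3 * #|` good F0| <= 2 * #|` good (v |` F0)%fset|) ->
  2 ^ (c (cls E) + cls E + 2) *
    #|` [fset x in extensions F v | `[< bad E (fun w => w \in x) >]]%fset| <= #|` good F|.
Proof.
move=> vF EF IH; set B := [fset x in extensions F v | _]%fset.
have vFS : v \notin (F `\` S E)%fset by rewrite inE (negbTE vF) andbF.
have leB : #|` B| <= 2 * #|` good (F `\` S E)%fset|.
  have -> : #|` B| = #|` [fset (x `\` S E)%fset | x in B]%fset|.
    rewrite card_fset_inj // => x y; rewrite !in_fset_sep.
    move=> /andP[_ /asboolP bx] /andP[_ /asboolP by'] xy.
    have outside w : w \notin S E -> (w \in x) = (w \in y).
      by move=> wS; have /fsetP/(_ w) := xy; rewrite !inE wS.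
    apply/fsetP => w; have [wS|/outside//] := boolP (w \in S E).
    exact: bad_det bx by' outside w wS.
  rewrite -(card_extensions vFS); apply: fsubset_leq_card; apply/fsubsetP => y.
  case/imfsetP => x /=; rewrite in_fset_sep => /andP[/extensionsP[xF /goodP[xF' gx]] _] -> {y}.
  apply/extensionsP; split.
    apply/fsubsetP => w; rewrite in_fsetD => /andP[wS wx].
    by have := fsubsetP xF w wx; rewrite !inE wS.
  apply/goodP; split=> [|E' E'F bad'].
    apply/fsubsetP => w; rewrite in_fsetD1 !in_fsetD => /and3P[wv wS wx].
    by rewrite wS; apply: (fsubsetP xF'); rewrite in_fsetD1 wv.
  apply: (gx E'); first exact: fsubset_trans E'F (fsubsetDl _ _).
  apply: bad_local bad' => w wE'.
  by have := fsubsetP E'F _ wE'; rewrite !inE => /andP[-> _].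
have := drop_good IH (S E) (leqnn _); set k := #|` (F `&` S E)%fset|.
have le_k : 2 * (c (cls E) + cls E + 3) <= k.
  have : #|` S E| <= 1 + k; last by have := large E; lia.
  apply: leq_trans (_ : #|` (v |` (F `&` S E))%fset| <= _); last first.
    by rewrite cardfsU1; case: (_ \notin _).
  apply/fsubset_leq_card/fsubsetP => w wS; rewrite !inE wS andbT.
  by have := fsubsetP EF _ (fsubsetP (sub_supp E) _ wS); rewrite !inE.
set e := c (cls E) + cls E + 3 in le_k *.
have e_k := exp2_exp3 le_k.
have -> : c (cls E) + cls E + 2 = e.-1 by rewrite /e; lia.
have : 2 ^ e = 2 * 2 ^ e.-1 by rewrite -expnS prednK // /e; lia.
move=> e2 h; rewrite e2 in e_k.
have p0 := expn_gt0 2 k.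
move: h e_k leB p0; set g' := #|` good (F `\` _)%fset|; set g := #|` good F|.
move=> h e_k leB p0.
have : 2 ^ k * (2 * 2 ^ e.-1 * g') <= 2 ^ k * g.
  by apply: leq_trans h; rewrite mulnA [2 ^ k * _]mulnC leq_mul.
rewrite leq_pmul2l // => le_g; apply: leq_trans le_g.
by rewrite [2 * _]mulnC -mulnA leq_mul.
Qed.

(** Each good assignment on F has two extensions to the new vertex v.  An
    extension that fails is bad for an event that involves v, and all these
    events together spoil at most a quarter of the extensions. *)
Lemma good_grows F v : v \notin F -> 3 * #|` good F| <= 2 * #|` good (v |` F)%fset|.
Proof.
have [n le_n] := ubnP #|` F|; elim: n F v le_n => // n IHn F v le_n vF.
pose valid E := (supp E `<=` v |` F)%fset && (v \in supp E).
pose B E := [fset x in extensions F v | `[< bad E (fun w => w \in x) >]]%fset.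
have [l [ul vl cov]] : exists l : seq I, [/\ uniq l, all valid l &
    forall x, x \in extensions F v -> x \notin good (v |` F)%fset ->
      exists2 E, E \in l & x \in B E].
  have cover x : x \in extensions F v -> x \notin good (v |` F)%fset ->
      exists2 E, valid E & x \in B E.
    move=> xe xng; have [xF /goodP[_ gx]] := extensionsP _ _ _ xe.
    have [E [EF bE]] : exists E, (supp E `<=` v |` F)%fset /\ bad E (fun w => w \in x).
      apply: contrapT => nE; case/negP: xng; apply/goodP; split=> // E EF bE.
      by apply: nE; exists E.
    exists E; last by rewrite in_fset_sep xe; apply/asboolP.
    rewrite /valid EF /=; apply: contraT => vE; case: (gx E).
      apply/fsubsetP => w wE; have := fsubsetP EF _ wE; rewrite !inE.
      by case/predU1P => // wv; rewrite -wv wE in vE.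
    apply: bad_local bE => w wE; rewrite !inE.
    by case: eqP => // wv; rewrite -wv wE in vE.
  (* One event per failing extension: the list of events must be finite. *)
  have [l [ul vl cov]] : exists l : seq I, [/\ uniq l, all valid l &
    forall x, x \in enum_fset (extensions F v) -> x \in extensions F v ->
      x \notin good (v |` F)%fset -> exists2 E, E \in l & x \in B E].
    elim: (enum_fset _) => [|x s [l [ul vl cov]]]; first by exists [::].
    have [/andP[xe xng]|nx] := boolP ((x \in extensions F v) && (x \notin good (v |` F)%fset)).
      have [E vE xE] := cover x xe xng.
      exists (undup (E :: l)); split; first exact: undup_uniq.
        by apply/allP => E'; rewrite mem_undup inE => /predU1P[->//|/(allP vl)].
      move=> y; rewrite inE => /predU1P[->|ys] ye yng.
        by exists E => //; rewrite mem_undup mem_head.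
      have [E' lE' yE'] := cov y ys ye yng.
      by exists E' => //; rewrite mem_undup inE lE' orbT.
    exists l; split=> // y; rewrite inE => /predU1P[->|ys] ye yng; last exact: cov.
    by rewrite ye yng in nx.
  by exists l; split=> // x xe; apply: cov.
pose g := #|` good F|.
have le_bad E : E \in l -> 2 ^ (c (cls E) + cls E + 2) * #|` B E| <= g.
  move=> /(allP vl)/andP[EF vE]; apply: few_bad => // F0 w lt_F0; apply: IHn.
  exact: leq_trans lt_F0 _.
have le_ext : 2 * g <= #|` good (v |` F)%fset| + \sum_(E <- l) #|` B E|.
  rewrite -(card_extensions vF).
  apply: leq_trans
    (_ : #|` good (v |` F)%fset| + #|` (\bigcup_(E <- l) B E)%fset| <= _); last first.
    by rewrite leq_add2l leq_card_bigfcup.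
  have := cardfsUI (good (v |` F)%fset) (\bigcup_(E <- l) B E)%fset.
  suff /fsubset_leq_card : (extensions F v `<=` good (v |` F) `|` \bigcup_(E <- l) B E)%fset by lia.
  apply/fsubsetP => x xe; rewrite in_fsetU; have [//|xng] := boolP (x \in good _).
  have [E lE xE] := cov x xe xng.
  by apply/orP; right; apply/bigfcupP; exists E; rewrite // lE.
pose K := (\max_(E <- l) cls E).+1.
pose N k := \sum_(E <- l | cls E == k) #|` B E|.
have sumN : \sum_(E <- l) #|` B E| = \sum_(k < K) N k.
  rewrite (exchange_big_dep predT) //=; apply: eq_big_seq => E lE.
  have ltE : cls E < K by rewrite ltnS; apply: leq_bigmax_seq.
  rewrite (big_pred1 (Ordinal ltE)) // => k.
have : 2 * (\sum_(k < K) N k) <= g.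
  apply: geometric_half => k; rewrite /N -big_filter.
  set lk := [seq E <- l | cls E == k].
  have szk : size lk <= 2 ^ c k.
    apply: (few (v := v)); first exact: filter_uniq.
    by move=> E; rewrite mem_filter => /andP[/eqP -> /(allP vl)/andP[]].
  have le_lk : 2 ^ (c k + k + 2) * (\sum_(E <- lk) #|` B E|) <= size lk * g.
    rewrite big_distrr /= -sum1_size big_distrl /= big_seq [in leqRHS]big_seq.
    apply: leq_sum => E; rewrite mem_filter mul1n => /andP[/eqP <- lE].
    exact: le_bad.
  have p0 : 0 < 2 ^ c k by rewrite expn_gt0.
  rewrite -(leq_pmul2l p0); apply: leq_trans (_ : size lk * g <= _); last first.
    by rewrite leq_mul2r szk orbT.
  by apply: leq_trans le_lk; rewrite mulnA -expnD addnA.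
rewrite -sumN -/g; lia.
Qed.

Lemma local_lemma : exists x : Y -> bool, forall E, ~ bad E x.
Proof.
have good_n0 F : 0 < #|` good F|.
  have [n le_n] := ubnP #|` F|; elim: n F le_n => // n IHn F le_n.
  have [->|[v vF]] := fset_0Vmem F.
    rewrite cardfs_gt0; apply/fset0Pn; exists fset0; apply/goodP.
    split=> // E; rewrite fsubset0 => E0; by have := supp_neq0 E; rewrite E0.
  have := good_grows (F := (F `\ v)%fset) (v := v); rewrite fsetD1K // !inE eqxx.
  move=> /(_ isT); have := IHn (F `\ v)%fset; rewrite (cardfsD1 v F) vF in le_n.
  by move=> /(_ le_n); lia.
have /choice [x xP] F : exists x, x \in good F.
  by apply/fset0Pn; rewrite -cardfs_gt0.
pose FF : set_system {fset Y} :=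
  filter_from setT (fun F0 => [set F | (F0 `<=` F)%fset]%classic).
have PF : ProperFilter FF.
  apply: filter_from_proper => [|F0 _]; last by exists F0 => /=.
  apply: filter_from_filter; first by exists fset0.
  move=> A B _ _; exists (A `|` B)%fset => // F /=; rewrite fsubUset.
  by case/andP.
have [h hP] := compactness (fun F v => v \in x F) PF.
exists h => E bE.
have [|F /= EF eqF] :=
    hP (enum_fset (supp E)) [set F | (supp E `<=` F)%fset]%classic.
  by exists (supp E).
have /goodP[_ /(_ E EF)] := xP F; apply; apply: bad_local bE => v vE.
by rewrite eqF.
Qed.

End LocalLemma.

(** * Distances, balls and separated sets *)

Section Metric.
Variable Y : ggraph.
Hypothesis Yconn : connected_graph Y.
Implicit Types (u v w y : Y) (n : nat).

Lemma walk_cat u v w m n : walk u v m -> walk v w n -> walk u w (m + n).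
Proof.
move=> [s [ps ls <-]] [t [pt lt <-]]; exists (s ++ t).
by rewrite cat_path last_cat size_cat ps ls pt.
Qed.

Lemma walk1 u v : adj u v -> walk u v 1.
Proof. by move=> uv; exists [:: v]; rewrite /= uv. Qed.

Lemma walk_sym u v n : walk u v n -> walk v u n.
Proof.
move=> [s [ps <- <-]]; elim: s u ps => [|x s IHs] u /=; first by exists [::].
case/andP=> ux /IHs xs; rewrite -addn1; apply: walk_cat xs _.
by apply: walk1; rewrite adj_sym.
Qed.

Lemma dist_walk u v : walk u v (dist u v).
Proof.
rewrite /dist; case: pselect => [ex|[]]; last first.
  by have [n w] := Yconn u v; exists n; apply/asboolP.
by case: ex_minnP => m /asboolP.
Qed.

Lemma dist_min u v n : walk u v n -> dist u v <= n.
Proof. by move=> w; apply/(dist_leP _ _ _ Yconn); exists n. Qed.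

Lemma dist_sym u v : dist u v = dist v u.
Proof.
by apply/eqP; rewrite eqn_leq !dist_min //; apply/walk_sym/dist_walk.
Qed.

Lemma dist_tri u v w : dist u w <= dist u v + dist v w.
Proof. by apply/dist_min/walk_cat; exact: dist_walk. Qed.

Lemma dist_eq0 u v : dist u v = 0 -> u = v.
Proof.
move=> d0; have := dist_walk u v; rewrite d0 => -[s [_ <-]].
by move/size0nil => ->.
Qed.

Lemma dist_step u v n : dist u v = n.+1 -> exists2 w, adj u w & dist w v = n.
Proof.
move=> dn; have := dist_walk u v; rewrite dn.
case=> -[|w s] [] //= /andP[uw ps] ls [sz]; exists w => //.
apply/eqP; rewrite eqn_leq; apply/andP; split.
  by rewrite -sz; apply: dist_min; exists s.
have := dist_tri u w v; rewrite dn.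
by have := dist_min (walk1 uw); lia.
Qed.

Lemma adj_dist u v : adj u v -> dist u v = 1.
Proof.
move=> uv; have := dist_min (walk1 uv).
case d0: (dist u v) => [|[]] // _.
by move: uv; rewrite (dist_eq0 d0) adj_irr.
Qed.

Lemma dist1_adj u v : dist u v = 1 -> adj u v.
Proof. by move/dist_step => [w uw /dist_eq0 <-]. Qed.

Lemma dist_adj u v w : adj v w -> dist u w <= dist u v + 1.
Proof. by move/adj_dist => <-; apply: dist_tri. Qed.

Lemma dist_between u v i : i <= dist u v ->
  exists2 w, dist u w = i & dist w v = dist u v - i.
Proof.
elim: i => [|i IHi] le_i; first by exists u; rewrite ?dist0 ?subn0.
have [w uw wv] := IHi (ltnW le_i).
have [w' ww' w'v] : exists2 w', adj w w' & dist w' v = dist u v - i.+1.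
  by apply: dist_step; rewrite wv; lia.
exists w' => //; have := dist_tri u w' v.
by have := dist_adj u ww'; lia.
Qed.

Definition neighbors u : {fset Y} := fset_set [set v | adj u v]%classic.

Lemma in_neighbors u v : (v \in neighbors u) = adj u v.
Proof.
by rewrite in_fset_set ?in_setE; [apply/asboolP/idP|exact: finite_adj].
Qed.

Fixpoint ball u n : {fset Y} :=
  if n is n'.+1 then (\bigcup_(v <- ball u n') (v |` neighbors v))%fset
  else [fset u]%fset.

Lemma in_ball u n v : (v \in ball u n) = (dist u v <= n).
Proof.
elim: n v => [|n IHn] v /=.
  by rewrite inE leqn0; apply/eqP/eqP => [->|/dist_eq0//]; rewrite dist0.
apply/bigfcupP/idP => [[w /andP[wb _]]|].
  rewrite !inE in_neighbors; move: wb; rewrite IHn => le_n /predU1P[->|wv].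
    exact: leqW.
  by have := dist_adj u wv; lia.
rewrite leq_eqVlt => /predU1P[dn|]; last first.
  by rewrite ltnS => le_n; exists v; rewrite ?IHn ?le_n // fset1U1.
have [w uw wv] : exists2 w, dist u w = n & dist w v = dist u v - n.
  by apply: dist_between; rewrite dn.
exists w; first by rewrite IHn uw leqnn.
by rewrite !inE in_neighbors dist1_adj ?orbT //; lia.
Qed.

Section Bounded.
Variable Delta : nat.
Hypothesis Ydeg : forall u, degree u <= Delta.
Hypothesis Yinf : infinite_set [set: Y]%classic.

Lemma card_ball u n : #|` ball u n| <= Delta.+1 ^ n.
Proof.
elim: n => [|n IHn] /=; first by rewrite cardfs1.
apply: leq_trans (leq_card_bigfcup _ _) _; rewrite expnSr.
apply: leq_trans (_ : #|` ball u n| * Delta.+1 <= _); last by rewrite leq_mul2r IHn orbT.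
rewrite -[#|` ball u n|]sum1_size big_distrl /=; apply: leq_sum => v _.
by rewrite mul1n cardfsU1 -addn1 addnC leq_add ?leq_b1 //; apply: Ydeg.
Qed.

Lemma sphere_neq0 u n : exists v, dist u v = n.
Proof.
have [v lt_n] : exists v, n < dist u v.
  apply: contrapT => nex; apply: Yinf.
  apply: sub_finite_set (finite_fset (ball u n)) => v _ /=.
  by rewrite in_ball leqNgt; apply/negP => lt_n; apply: nex; exists v.
by have [w uw _] := dist_between (ltnW lt_n); exists w.
Qed.

Lemma card_ball_add u n k : #|` ball u n| + k <= #|` ball u (n + k)|.
Proof.
elim: k => [|k IHk]; first by rewrite !addn0.
rewrite !addnS; apply: leq_ltn_trans IHk _.
apply: fproper_ltn_card; rewrite fproperE; apply/andP; split.
  by apply/fsubsetP => v; rewrite !in_ball; apply: leqW.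
have [v uv] := sphere_neq0 u (n + k).+1.
by apply/fsubsetPn; exists v; rewrite !in_ball uv ?ltnn.
Qed.

Lemma card_ball_gt u n : n < #|` ball u n|.
Proof. by have := card_ball_add u 0 n; rewrite cardfs1. Qed.

Lemma two_le_max_degree : 1 < Delta.
Proof.
have [u _] : exists u : Y, True.
  apply: contrapT => nex; apply: Yinf; rewrite (_ : setT = set0) // -subset0 => v _.
  by case: nex; exists v.
have [v uv] := sphere_neq0 u 2.
have [w uw wv] := dist_step uv.
apply: leq_trans (Ydeg w).
have sub : ([fset u; v] `<=` neighbors w)%fset.
  apply/fsubsetP => x; rewrite !inE in_neighbors => /orP[]/eqP->.
    by rewrite adj_sym.
  exact: dist1_adj.
apply: leq_trans (fsubset_leq_card sub); rewrite cardfs2.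
by case: eqP uv => // ->; rewrite dist0.
Qed.

Lemma card_cover (P S : {fset Y}) k :
  (forall p, p \in P -> exists2 s, s \in S & dist s p <= k) ->
  #|` P| <= #|` S| * Delta.+1 ^ k.
Proof.
move=> cov; have sub : (P `<=` \bigcup_(s <- S) ball s k)%fset.
  apply/fsubsetP => p /cov[s sS sp]; apply/bigfcupP; exists s; rewrite ?sS //.
  by rewrite in_ball.
apply: leq_trans (fsubset_leq_card sub) _.
apply: leq_trans (leq_card_bigfcup _ _) _.
rewrite -[#|` S|]sum1_size big_distrl /=; apply: leq_sum => s _.
by rewrite mul1n card_ball.
Qed.

End Bounded.

Lemma maximal_separated (P : set Y) k : 0 < k -> exists S : set Y, [/\ (S `<=` P)%classic,
   forall s s', S s -> S s' -> s <> s' -> k <= dist s s' &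
   forall p, P p -> exists2 s, S s & dist s p < k].
Proof.
move=> k0; pose sep (S : set Y) := (S `<=` P)%classic /\
  forall s s', S s -> S s' -> s <> s' -> k <= dist s s'.
have [F subF totF|S [[SP Ssep] maxS]] := @Zorn_bigcup Y sep.
  split=> [v [S FS]|s s' [S FS Ss] [S' FS' Ss']]; first by case: (subF S FS) => + _; apply.
  have [SS'|S'S] := totF S S' FS FS'.
    by case: (subF _ FS') => _; apply=> //; apply: SS'.
  by case: (subF _ FS) => _; apply=> //; apply: S'S.
exists S; split=> // p Pp; apply: contrapT => nex.
have far s : S s -> k <= dist s p.
  by move=> Ss; rewrite leqNgt; apply/negP => lt_k; apply: nex; exists s.
apply: (maxS (S `|` [set p])%classic).
  split; first by move=> s; left.
  move=> /(_ p (or_intror erefl)) Sp; have := far _ Sp; rewrite dist0; lia.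
split=> [s [/SP//|->//]|s s' [Ss|->] [Ss'|->]] //; first exact: Ssep.
- by move=> _; apply: far.
- by move=> _; rewrite dist_sym; apply: far.
Qed.

End Metric.
Arguments ball : simpl never.

(** * Isomorphisms of colored disks *)

Section PartialIso.

(** A pointed colored isomorphism of disks, given by a function on all the
    vertices whose values off the disk are irrelevant.  This avoids the subtypes
    of [disk]: restriction and composition are then about plain functions. *)
Definition piso (Y Z : ggraph) (T : Type) (phi : Y -> T) (psi : Z -> T)
    (u : Y) (v : Z) (R : nat) (f : Y -> Z) : Prop :=
  f u = v /\ exists g : Z -> Y,
  [/\ forall a, dist u a <= R -> dist v (f a) <= R /\ g (f a) = a,
      forall b, dist v b <= R -> dist u (g b) <= R /\ f (g b) = b,
      forall a a', dist u a <= R -> dist u a' <= R ->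
        uedges (f a) (f a') = uedges a a' /\ dedges (f a) (f a') = dedges a a' &
      forall a, dist u a <= R -> psi (f a) = phi a].

Lemma piso_id (Y : ggraph) T (phi : Y -> T) u R : piso phi phi u u R id.
Proof. by split=> //; exists id. Qed.

Section Basic.
Variables (Y Z : ggraph) (T : Type) (phi : Y -> T) (psi : Z -> T).
Variables (u : Y) (v : Z) (R : nat) (f : Y -> Z).
Hypothesis iso_f : piso phi psi u v R f.

Lemma piso_center : f u = v. Proof. by case: iso_f. Qed.

Lemma piso_inj a a' : dist u a <= R -> dist u a' <= R -> f a = f a' -> a = a'.
Proof.
case: iso_f => _ [g [fg _ _ _]] /fg[_ ga] /fg[_ ga'] eqf.
by rewrite -ga -ga' eqf.
Qed.

Lemma piso_color a : dist u a <= R -> psi (f a) = phi a.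
Proof. by case: iso_f => _ [g [_ _ _ col]]; apply: col. Qed.

Lemma piso_adj a a' : dist u a <= R -> dist u a' <= R ->
  adj (f a) (f a') = adj a a'.
Proof.
move=> ua ua'; rewrite /adj.
case: iso_f => _ [g [_ _ edg _]].
have [-> ->] := edg _ _ ua ua'; have [_ ->] := edg _ _ ua' ua.
by congr (~~ _ && _); apply/eqP/eqP => [/(piso_inj ua ua')|->].
Qed.

Lemma piso_sym : exists g,
  [/\ piso psi phi v u R g, forall a, dist u a <= R -> g (f a) = a &
      forall b, dist v b <= R -> dist u (g b) <= R /\ f (g b) = b].
Proof.
have [fu [g [fg gf edg col]]] := iso_f.
exists g; split=> // [|a /fg[]//]; split.
  by rewrite -fu; case: (fg u) => //; rewrite dist0.
exists f; split=> // [b b' vb vb'|b vb].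
  have [ub fb] := gf _ vb; have [ub' fb'] := gf _ vb'.
  by have [<- <-] := edg _ _ ub ub'; rewrite fb fb'.
by have [ub fb] := gf _ vb; rewrite -{2}fb col.
Qed.

Lemma piso_recolor T' (phi' : Y -> T') (psi' : Z -> T') :
  (forall a, dist u a <= R -> psi' (f a) = phi' a) -> piso phi' psi' u v R f.
Proof. by move=> col; case: iso_f => fu [g [? ? ? _]]; split=> //; exists g. Qed.

Hypothesis (Yconn : connected_graph Y) (Zconn : connected_graph Z).

Lemma piso_walk w a n : dist u w + n <= R -> walk w a n -> walk (f w) (f a) n.
Proof.
move=> + [s [ps <- szn]]; rewrite -szn => {szn}.
elim: s w ps => [|x s IHs] w /=; first by exists [::].
case/andP => wx ps le_R; rewrite -add1n.
have ux := dist_adj Yconn u wx.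
apply: walk_cat (IHs x ps _); last by lia.
by apply: walk1; rewrite piso_adj //; lia.
Qed.

Lemma piso_dist_le w a : dist u w + dist w a <= R ->
  dist (f w) (f a) <= dist w a.
Proof. by move=> le_R; apply/dist_min/piso_walk/dist_walk. Qed.

End Basic.

Section Connected.
Variables (Y Z : ggraph) (T : Type) (phi : Y -> T) (psi : Z -> T).
Variables (u : Y) (v : Z) (R : nat) (f : Y -> Z).
Hypothesis (Yconn : connected_graph Y) (Zconn : connected_graph Z).
Hypothesis iso_f : piso phi psi u v R f.

(** A shortest path from w to a stays in the disk of radius
    dist u w + dist w a around u, and so does its image. *)
Lemma piso_dist w a : dist u w + dist w a <= R -> dist (f w) (f a) = dist w a.
Proof.
move=> le_R; apply/eqP; rewrite eqn_leq (piso_dist_le iso_f) //=.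
have [g [iso_g gf _]] := piso_sym iso_f.
have ua : dist u a <= R by apply: leq_trans (dist_tri _ _ w _) le_R.
have uw : dist u w <= R by apply: leq_trans (leq_addr _ _) le_R.
have := piso_dist_le iso_g Zconn Yconn (w := f w) (a := f a).
rewrite !gf //; apply; apply: leq_trans (le_R); apply: leq_add.
  have := piso_dist_le iso_f Yconn Zconn (w := u) (a := w).
  by rewrite dist0 (piso_center iso_f) => /(_ uw).
exact: (piso_dist_le iso_f Yconn Zconn le_R).
Qed.

Lemma piso_dist_center a : dist u a <= R -> dist v (f a) = dist u a.
Proof. by move=> ua; rewrite -(piso_center iso_f) piso_dist // dist0. Qed.

End Connected.

Section Restriction.
Variables (Y Z : ggraph) (T : Type) (phi : Y -> T) (psi : Z -> T).
Variables (u : Y) (v : Z) (R : nat) (f : Y -> Z).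
Hypothesis (Yconn : connected_graph Y) (Zconn : connected_graph Z).
Hypothesis iso_f : piso phi psi u v R f.

Lemma piso_sub w R' : dist u w + R' <= R -> piso phi psi w (f w) R' f.
Proof.
move=> le_R; split=> //; have [g [iso_g gf fg]] := piso_sym iso_f.
have near a : dist w a <= R' -> dist u a <= R.
  by move=> wa; apply: leq_trans (dist_tri Yconn _ w _) _; lia.
have uw : dist u w <= R by lia.
have vfw := piso_dist_center Yconn Zconn iso_f uw.
have near' b : dist (f w) b <= R' -> dist v b <= R.
  by move=> wb; apply: leq_trans (dist_tri Zconn _ (f w) _) _; rewrite vfw; lia.
exists g; split=> [a wa|b wb|a a' /near ua /near ua'|a /near].
- by rewrite (piso_dist Yconn Zconn iso_f) ?gf ?near //; lia.
- have [ub fb] := fg _ (near' _ wb); split=> //.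
  have := piso_dist Zconn Yconn iso_g (w := f w) (a := b).
  by rewrite gf // => ->; lia.
- by case: iso_f => _ [g' [_ _ ed _]]; apply: ed.
- exact: (piso_color iso_f).
Qed.

End Restriction.

Lemma piso_comp (X Y Z : ggraph) (T : Type) (chi : X -> T) (phi : Y -> T)
    (psi : Z -> T) t u v R f g :
  piso chi phi t u R f -> piso phi psi u v R g -> piso chi psi t v R (g \o f).
Proof.
move=> [ft [f' [ff' f'f edf colf]]] [gu [g' [gg' g'g edg colg]]].
split; first by rewrite /= ft gu.
exists (f' \o g'); split=> [a ta|c vc|a a' ta ta'|a ta] /=.
- by have [ufa f'a] := ff' _ ta; have [vga ->] := gg' _ ufa.
- by have [ugc ggc] := g'g _ vc; have [tfc ->] := f'f _ ugc.
- have [ufa _] := ff' _ ta; have [ufa' _] := ff' _ ta'.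
  by have [-> ->] := edg _ _ ufa ufa'; apply: edf.
- by have [ufa _] := ff' _ ta; rewrite colg ?colf.
Qed.

Lemma colored_disk_equivP (Y Z : ggraph) (T : Type) (phi : Y -> T)
    (psi : Z -> T) u v R :
  colored_disk_equiv phi psi u v R <-> exists f, piso phi psi u v R f.
Proof.
split=> [[F [[[G FG GF] ue de] Fc Fcol]]|[f [fu [g [fg gf ed col]]]]].
  pose f (a : Y) : Z := if insub a is Some p then val (F p) else v.
  pose g (b : Z) : Y := if insub b is Some p then val (G p) else u.
  have fE a (ua : dist u a <= R) : f a = val (F (exist _ a ua)).
    rewrite /f; case: insubP => [p _ pa|]; last by rewrite ua.
    by congr (val (F _)); apply: val_inj.
  have gE b (vb : dist v b <= R) : g b = val (G (exist _ b vb)).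
    rewrite /g; case: insubP => [p _ pb|]; last by rewrite vb.
    by congr (val (G _)); apply: val_inj.
  exists f; split; first by rewrite (fE u (center_subproof u R)) -/(center u R) Fc.
  exists g; split=> [a ua|b vb|a a' ua ua'|a ua].
  - rewrite (fE a ua); case FE: (F _) => [b vb] /=; split=> //.
    by rewrite (gE b vb) -FE FG.
  - rewrite (gE b vb); case GE: (G _) => [a ua] /=; split=> //.
    by rewrite (fE a ua) -GE GF.
  - by rewrite !fE; split; [apply: ue|apply: de].
  - by rewrite fE; apply: Fcol.
pose F (p : disk u R) : disk v R := exist _ (f (val p)) (fg _ (valP p)).1.
pose G (p : disk v R) : disk u R := exist _ (g (val p)) (gf _ (valP p)).1.
exists F; split.
- split.
  + by exists G => p; apply: val_inj => /=; [case: (fg _ (valP p))|case: (gf _ (valP p))].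
  + by move=> p q; case: (ed _ _ (valP p) (valP q)).
  + by move=> p q; case: (ed _ _ (valP p) (valP q)).
- by apply: val_inj.
- by move=> p; apply: col (valP p).
Qed.

Lemma disk_equivP (Y Z : ggraph) (u : Y) (v : Z) R :
  disk_equiv u v R <-> exists f, piso (fun=> tt) (fun=> tt) u v R f.
Proof.
rewrite -colored_disk_equivP; split=> [[F [isoF Fc]]|[F [isoF Fc _]]]; exists F.
  by split.
by split.
Qed.

End PartialIso.

(** * Breaking the bounded displacements of a rigid coloring *)

Lemma size_pairs_le (I : eqType) (Y : choiceType) (l : seq I)
    (h : I -> Y * Y) (B : {fset Y}) :
  uniq l -> {in l &, injective h} ->
  (forall i, i \in l -> (h i).1 \in B /\ (h i).2 \in B) ->
  size l <= #|` B| * #|` B|.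
Proof.
move=> ul injh hB; rewrite -(size_map h).
rewrite -(size_allpairs pair (enum_fset B) (enum_fset B)).
apply: uniq_leq_size; first by rewrite map_inj_in_uniq.
move=> _ /mapP[i il ->]; have [h1 h2] := hB i il.
by apply/allpairsP; exists (h i); split=> //; case: (h i).
Qed.

Section Toggles.
Variables (Y : ggraph) (Delta : nat).
Hypothesis Yconn : connected_graph Y.
Hypothesis Ydeg : forall u : Y, degree u <= Delta.
Hypothesis Yinf : infinite_set [set: Y]%classic.

Definition zero_on (phi : Y -> nat) (X : set Y) (x : Y -> bool) (v : Y) : nat :=
  if `[< X v >] && x v then 0 else phi v.

(** Two isomorphisms of disks that agree at a vertex agree at its neighbors, as
    long as the distance to the boundary is at least C. *)
Definition rigid (phi : Y -> nat) C := forall u v v' R f f' w w',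
  piso phi phi u v R f -> piso phi phi u v' R f' -> dist u w + C <= R ->
  f w = f' w -> adj w w' -> f w' = f' w'.

Lemma rigid_agree (phi : Y -> nat) C u v v' R f f' q w :
  rigid phi C -> piso phi phi u v R f -> piso phi phi u v' R f' -> q + C <= R ->
  dist u w <= q -> f w = f' w -> forall a, dist u a <= q -> f a = f' a.
Proof.
move=> rig isof isof' le_R uw fw.
have fu : f u = f' u.
  case n_w: (dist w u) => [|n]; first by rewrite -(dist_eq0 Yconn n_w).
  elim: n w uw fw n_w => [|n IHn] w uw fw n_w.
    have [w' ww' w'u] := dist_step Yconn n_w.
    rewrite -(dist_eq0 Yconn w'u); apply: (rig _ _ _ _ _ _ w _ isof isof') => //.
    by apply: leq_trans le_R; rewrite leq_add2r.
  have [w' ww' w'u] := dist_step Yconn n_w.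
  apply: (IHn w') => //; first by move: n_w w'u; rewrite ![dist _ u](dist_sym Yconn); lia.
  apply: (rig _ _ _ _ _ _ w _ isof isof') => //; apply: leq_trans le_R.
  by rewrite leq_add2r.
move=> a; move n_a: (dist u a) => n; elim: n a n_a => [|n IHn] a n_a le_q.
  by rewrite -(dist_eq0 Yconn n_a).
have [a' ua' a'a] : exists2 w, dist u w = n & dist w a = dist u a - n.
  by apply: dist_between => //; rewrite n_a.
apply: (rig _ _ _ _ _ _ a' a isof isof').
- by rewrite ua'; apply: leq_trans le_R; rewrite leq_add2r ltnW.
- by apply: IHn => //; apply: ltnW.
- by apply: dist1_adj => //; rewrite a'a n_a; lia.
Qed.

Variables (phi : Y -> nat) (X : set Y) (C k : nat).
Hypothesis phi_rigid : rigid phi C.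
Hypothesis phi_X : forall s, X s -> phi s != 0.
Hypothesis X_dense : forall p, exists2 s, X s & dist s p <= k.
Hypothesis recover : forall x u v R f,
  piso (zero_on phi X x) (zero_on phi X x) u v (R + C) f -> piso phi phi u v R f.

(** For displacements up to D, a vertex u is thin if its ball of radius wide has
    fewer than 2^m vertices.  Thin vertices use the toggles at distance at most
    q1, thick ones those at distance at most q2; R1 and R2 add the margin that
    rigidity requires.  All radii are linear in m, which is why a suitable m
    exists. *)
Let b := Delta.+1 ^ k.
Let reach D m := 3 * b * (7 + 4 * m + 4 * D).
Let q1 D m := reach D m + k.
Let R1 D m := q1 D m + C.
Let wide D m := 2 * (R1 D m + C + D).
Let q2 D m := wide D m + k.
Let R2 D m := q2 D m + C.

Lemma thick_bound D : exists m,
  3 * b * (9 + 4 * D + 4 * Delta * (R2 D m + C + D)) <= 2 ^ m.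
Proof.
have [m le_m] := exp2_dominates (3 * b * (4 * Delta * (2 * (3 * b * 4))))
  (3 * b * (9 + 4 * D + 4 * Delta * (R2 D 0 + C + D))).
exists m; apply: leq_trans le_m; rewrite /R2 /q2 /wide /R1 /q1 /reach; lia.
Qed.

(** The bad event for (D, u, v) is that some isomorphism of colored disks sends
    u to v.  By rigidity there is at most one candidate f, whatever the bits,
    and it moves every toggle s near u: otherwise f would be the identity.  If f
    preserves colors, the bit at s equals the bit at f s (or a fixed value, if
    f s is not a toggle), so the bits on a third of the toggles are determined
    by the other bits. *)
Theorem toggles_break_displacements : exists x, forall D, exists R, forall u v,
  u <> v -> dist u v <= D -> forall f,
  ~ piso (zero_on phi X x) (zero_on phi X x) u v R f.
Proof.
have /choice [m mP] := thick_bound.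
pose thin D (u : Y) := #|` ball u (wide D (m D))| < 2 ^ m D.
pose q D (u : Y) := if thin D u then q1 D (m D) else q2 D (m D).
pose valid (i : nat * Y * Y) := let: (D, u, v) := i in
  [/\ u <> v, dist u v <= D & exists f, piso phi phi u v (q D u + C) f].
pose I := {i : nat * Y * Y | `[< valid i >]}.
pose bad (i : I) x := let: (D, u, v) := val i in exists f,
  piso (zero_on phi X x) (zero_on phi X x) u v (q D u + C + C) f.
pose supp (i : I) := let: (D, u, v) := val i in
  (ball u (q D u + C + C) `|` ball v (q D u + C + C))%fset.
pose cls (i : I) := let: (D, u, v) := val i in 2 * D + ~~ thin D u.
pose c j := if odd j then 2 * Delta * (R2 j./2 (m j./2) + C + j./2) else 2 * m j./2.
have c0 D : c (2 * D + 0) = 2 * m D.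
  by rewrite /c addn0 mul2n odd_double doubleK.
have c1 D : c (2 * D + 1) = 2 * Delta * (R2 D (m D) + C + D).
  by rewrite /c addn1 mul2n /= odd_double /= uphalf_double.
have /choice [S SP] (i : I) : exists S : {fset Y}, let: (D, u, v) := val i in
    [/\ forall s, s \in S -> X s /\ dist u s <= q D u,
        1 + 2 * (c (cls i) + cls i + 3) <= #|` S| &
        exists2 f, piso phi phi u v (q D u + C) f & {in S &, forall s s', f s != s'}].
  case: i => -[[D u] v] /= vi; rewrite /cls /=.
  have /asboolP[neq_uv le_D [f isof]] := vi.
  pose Q := [fset s in ball u (q D u) | `[< X s >]]%fset.
  have QP s : s \in Q -> X s /\ dist u s <= q D u.
    by rewrite in_fset_sep in_ball // => /andP[us /asboolP].
  have [||S [SQ leS indS]] := @far_apart_third Y f Q.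
  - by move=> s s' /QP[_ us] /QP[_ us']; apply: (piso_inj isof); lia.
  - move=> s /QP[_ us]; apply/eqP => fs; apply: neq_uv.
    rewrite -(piso_center isof).
    by rewrite (rigid_agree phi_rigid isof (piso_id phi u _) (leqnn _) us fs) ?dist0.
  exists S; split=> [s /(fsubsetP SQ)/QP//||]; last by exists f.
  pose n := q D u - k.
  have le_kq : k <= q D u by rewrite /q /q1 /q2; case: ifP => _; lia.
  have : #|` ball u n| <= #|` Q| * b.
    apply: card_cover => // p; rewrite in_ball // => up.
    have [s Xs sp] := X_dense p; exists s => //.
    rewrite in_fset_sep in_ball //; apply/andP; split; last exact/asboolP.
    by have := dist_tri Yconn u p s; rewrite [dist p s]dist_sym // /n in up *; lia.
  have b0 : 0 < b by rewrite /b expn_gt0.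
  rewrite /n /q; case: ifP => thinD /=; rewrite ?c0 ?c1.
  - rewrite /q1 addnK => le_b; have := leq_trans (card_ball_gt Yconn Yinf u _) le_b.
    rewrite /reach => lt_b.
    have : b * (3 * (7 + 4 * m D + 4 * D)) < b * (3 * #|` S|).
      rewrite mulnA [b * 3]mulnC; apply: leq_trans lt_b _.
      by rewrite mulnC leq_mul2l leS orbT.
    rewrite ltn_pmul2l //; move: #|` S| (m D) => s m'; clear; lia.
  - rewrite /q2 addnK => le_b.
    have : b * (3 * (9 + 4 * D + 4 * Delta * (R2 D (m D) + C + D))) <= b * (3 * #|` S|).
      rewrite mulnA [b * 3]mulnC; apply: leq_trans (mP D) _.
      move: thinD; rewrite /thin ltnNge => /negbFE => le_m.
      apply: leq_trans le_m _; apply: leq_trans le_b _.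
      by rewrite mulnC leq_mul2l leS orbT.
    by rewrite leq_pmul2l //; move: #|` S| (R2 D (m D) + C + D) => s e; clear; lia.
have suppI i w : w \in supp i -> let: (D, u, v) := val i in
    dist w u <= q D u + C + C + D /\ dist w v <= q D u + C + C + D.
  case: i => -[[D u] v] /= vi; have /asboolP[_ le_D _] := vi.
  rewrite /supp /= inE !in_ball // ![dist w _]dist_sym //.
  have := dist_tri Yconn u v w; have := dist_tri Yconn v u w.
  rewrite [dist v u]dist_sym //; lia.
(* Class 2D is for thin vertices and class 2D + 1 for thick ones. *)
have [||||||x xP] := @local_lemma Y I supp S bad cls c.
- case=> -[[D u] v] /= vi; rewrite /supp /=; apply/fset0Pn; exists u.
  by rewrite inE in_ball // dist0.
- move=> i; have := SP i; rewrite /supp; case: (val i) => -[D u] v [SX _ _].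
  by apply/fsubsetP => s /SX[_ us]; rewrite inE in_ball //; apply/orP; left; lia.
- move=> i x x'; rewrite /supp /bad; case: (val i) => -[D u] v xx' [f isof].
  have col a : a \in (ball u (q D u + C + C) `|` ball v (q D u + C + C))%fset ->
      zero_on phi X x a = zero_on phi X x' a.
    by rewrite /zero_on => /xx' ->.
  exists f; apply: (piso_recolor isof) => a ua.
  rewrite -!col; first exact: (piso_color isof).
    by rewrite inE in_ball // ua.
  rewrite inE !in_ball //; apply/orP; right.
  by rewrite (piso_dist_center Yconn Yconn isof).
- move=> i x x' + + outside s sS; have := SP i; rewrite /bad.
  case: (val i) => -[D u] v [SX _ [f0 isof0 indS]] [f isof] [f' isof'].
  have [Xs us] := SX s sS.
  have agree g : piso phi phi u v (q D u + C) g -> g s = f0 s.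
    move=> isog; apply: (rigid_agree phi_rigid isog isof0 (leqnn _) (w := u)) us.
      by rewrite dist0.
    by rewrite (piso_center isog) (piso_center isof0).
  have zeroE y g : piso (zero_on phi X y) (zero_on phi X y) u v (q D u + C + C) g ->
      y s = (zero_on phi X y (f0 s) == 0).
    move=> isog; rewrite -(agree g); last exact: recover isog.
    rewrite (piso_color isog); last by lia.
    by rewrite /zero_on (asboolT Xs) /=; case: (y s) => //; rewrite (negbTE (phi_X Xs)).
  rewrite (zeroE _ _ isof) (zeroE _ _ isof') /zero_on outside //.
  by apply/negP => f0S; have := indS s (f0 s) sS f0S; rewrite eqxx.
- by move=> i; have := SP i; case: (val i) => -[D u] v [].
- move=> w j l ul lP; case l0: l => [//|i0 l']; rewrite -l0.
  pose h (i : I) := ((val i).1.2, (val i).2).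
  pose D := j./2.
  have clsE i : i \in l -> (val i).1.1 = D /\ thin D (h i).1 = ~~ odd j.
    case/lP; rewrite /cls /h /D; case: (val i) => -[D' u] v /= <- _.
    have -> : (2 * D' + ~~ thin D' u)./2 = D'.
      by case: (thin D' u); rewrite ?addn0 ?addn1 mul2n /= ?uphalf_double ?doubleK.
    by rewrite oddD mul2n odd_double; case: (thin D' u).
  have injh : {in l &, injective h}.
    move=> i i' /clsE[+ _] /clsE[+ _]; rewrite /h => Di Di' [ui vi]; apply: val_inj.
    move: Di Di' ui vi => /=; case: (sval i) => -[? ?] ?; case: (sval i') => -[? ?] ? /=.
    by move=> -> -> -> ->.
  have nearI i : i \in l -> let r := q D (h i).1 + C + C + D in
      dist w (h i).1 <= r /\ dist w (h i).2 <= r.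
    move=> il; have [Di _] := clsE i il; have [_ wi] := lP i il; have := suppI i w wi.
    by rewrite /h; move: Di; case: (val i) => -[? ?] ? /= ->.
  have il0 : i0 \in l by rewrite l0 mem_head.
  have [_ thin0] := clsE _ il0; have [w0 _] := nearI _ il0.
  have pairs_le (B : {fset Y}) : (forall i, i \in l -> (h i).1 \in B /\ (h i).2 \in B) ->
      size l <= #|` B| * #|` B|.
    exact: size_pairs_le.
  have jE : j = 2 * D + odd j by rewrite mul2n addnC /D odd_double_half.
  rewrite [in leqRHS]jE; case: (boolP (odd j)) => oj; rewrite ?c0 ?c1.
  - apply: leq_trans (pairs_le (ball w (R2 D (m D) + C + D)) _) _.
      move=> i il; have [_ thini] := clsE _ il; have := nearI _ il.
      by rewrite !in_ball // /q thini oj /= /R2.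
    have leB := card_ball Ydeg w (R2 D (m D) + C + D).
    apply: leq_trans (leq_mul leB leB) _; rewrite -expnD -[2 * Delta * _]mulnA [2 * (_ * _)]mulnCA.
    rewrite expnM mul2n addnn; case: (_ .*2) => // n; rewrite leq_exp2r //.
    exact: ltn_expl.
  - move: thin0; rewrite (negbTE oj) /thin => /= thin0.
    rewrite mul2n -addnn expnD.
    apply: leq_trans (pairs_le (ball (h i0).1 (wide D (m D))) _) _; last first.
      by apply: leq_mul; apply: ltnW.
    move=> i il; have [_ thini] := clsE _ il; have [wi wi'] := nearI _ il.
    rewrite !in_ball //; have := dist_tri Yconn (h i0).1 w (h i).1.
    have := dist_tri Yconn (h i0).1 w (h i).2; rewrite [dist _ w]dist_sym //.
    move: w0 wi wi'; rewrite /q !thini /thin thin0 (negbTE oj) /wide /R1 /=; lia.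
exists x => D; exists (R2 D (m D) + C + C + R1 D (m D)) => u v neq_uv le_D f isof.
have isoR : piso (zero_on phi X x) (zero_on phi X x) u v (q D u + C + C) f.
  have := piso_sub Yconn Yconn isof (w := u) (R' := q D u + C + C).
  rewrite (piso_center isof); apply.
  by rewrite dist0 /q /R2 /R1; case: ifP => _; lia.
have vi : `[< valid (D, u, v) >].
  by apply/asboolP; split=> //; exists f; apply: recover isoR.
by apply: (xP (exist _ (D, u, v) vi)); exists f.
Qed.

End Toggles.

(** * Roots and levels at two scales *)

(** The boolean is the kind of a root: true for thick, false for thin.  The
    level of a vertex is a distance to the roots in which thin roots have a head
    start, so that each root owns the ball of its radius ([level_near]) and a
    vertex descends only to roots at distance less than three radii
    ([level_lt3]).  The capacities compare numbers of slots (at least the size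
    of the ball, less the ball of radius 9, divided by (Delta+1)^2) with the
    numbers of bits required by [local_lemma] when there are 2^(2 mass) thin or
    (Delta+1)^(14 radius) thick competitors. *)
Record nets (Y : ggraph) (Delta : nat) := Nets {
  roots : bool -> set Y;
  radius : bool -> nat;
  offset : bool -> nat;
  level : Y -> nat;
  mass : nat;
  roots_sep : forall t t' r r', roots t r -> roots t' r' -> r <> r' ->
    radius t + radius t' + 20 <= dist r r';
  roots_type : forall t t' r, roots t r -> roots t' r -> t = t';
  level_attained : forall w, exists t, exists2 r, roots t r & level w = offset t + dist w r;
  level_le : forall t r w, roots t r -> level w <= offset t + dist w r;
  level_lt3 : forall t r w, roots t r -> level w = offset t + dist w r -> dist w r < 3 * radius t;
  level_bound : forall w, level w < 3 * radius true;
  level_near : forall t r w, roots t r -> dist w r <= radius t + 1 -> level w = offset t + dist w r;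
  radius_ge20 : forall t, 20 <= radius t;
  radius_ratio : 14 * radius false <= radius true;
  roots_thin : forall r, roots false r -> #|` ball r (radius true)| < 2 ^ mass;
  roots_thick : forall r, roots true r -> 2 ^ mass <= #|` ball r (radius true)|;
  thin_capacity : Delta.+1 ^ 2 * (4 * mass + 7) + 9 <= radius false;
  thick_capacity :
    Delta.+1 ^ 9 + Delta.+1 ^ 2 * (28 * Delta * radius true + 9) <= 2 ^ mass
}.

Section NetsExist.
Variables (Y : ggraph) (Delta : nat).
Hypothesis Yconn : connected_graph Y.

(** Thick roots form a maximal separated set of vertices with heavy balls; thin
    roots form a maximal separated set, at a smaller scale, of the vertices far
    from all thick roots, which automatically have light balls.  The radius is
    linear in m, hence small compared with 2^m for some m. *)
Lemma nets_exist : inhabited (nets Y Delta).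
Proof.
pose b2 := Delta.+1 ^ 2.
pose a m := b2 * (4 * m + 7) + 27.
have [m cap] : exists m,
    Delta.+1 ^ 9 + b2 * (28 * Delta * (14 * a m) + 9) <= 2 ^ m.
  have [m le_m] := exp2_dominates (b2 * (28 * Delta * (14 * (b2 * 4))))
    (Delta.+1 ^ 9 + b2 * (28 * Delta * (14 * a 0) + 9)).
  exists m; apply: leq_trans le_m; rewrite /a; clear; lia.
pose sm := a m; pose bg := 14 * sm.
have sm27 : 27 <= sm by rewrite /sm /a leq_addl.
have [Nk [Nk_thick Nk_sep Nk_max]] := maximal_separated Yconn
  [set y | 2 ^ m <= #|` ball y bg|]%classic (k := 3 * bg) (ltac:(rewrite /bg; lia)).
have [Nn [Nn_far Nn_sep Nn_max]] := maximal_separated Yconn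
  [set y | forall s, Nk s -> 3 * bg <= dist s y]%classic (k := 3 * sm) (ltac:(lia)).
pose roots t := if t then Nk else Nn.
pose radius t := if t then bg else sm.
pose offset t := if t then 0 else 3 * bg - 3 * sm.
pose Lv w n := `[< exists t, exists2 r, roots t r & offset t + dist w r <= n >].
have bgE : bg = 14 * sm by [].
have cov w : exists t, exists2 r, roots t r & offset t + dist w r < 3 * bg.
  have [[s Nks lt_s]|nk] := pselect (exists2 s, Nk s & dist s w < 3 * bg).
    by exists true; exists s => //; rewrite /offset add0n dist_sym.
  have [|t Nnt lt_t] := Nn_max w.
    by move=> s Nks /=; rewrite leqNgt; apply/negP => lt_s; apply: nk; exists s.
  by exists false; exists t => //; rewrite /offset dist_sym //; lia.
have exL w : exists n, Lv w n.
  have [t [r rtr lt_r]] := cov w.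
  by exists (3 * bg); apply/asboolP; exists t; exists r => //; apply: ltnW.
pose level w := ex_minn (exL w).
have level_le t r w : roots t r -> level w <= offset t + dist w r.
  move=> rtr; rewrite /level; case: ex_minnP => n _; apply.
  by apply/asboolP; exists t; exists r.
have level_at w : exists t, exists2 r, roots t r & level w = offset t + dist w r.
  have : Lv w (level w) by rewrite /level; case: ex_minnP.
  move=> /asboolP[t [r rtr le_r]]; exists t; exists r => //.
  by apply/eqP; rewrite eqn_leq le_r level_le.
have level_lt w : level w < 3 * bg.
  have [t [r rtr lt_r]] := cov w.
  by apply: leq_ltn_trans (level_le _ _ _ rtr) lt_r.
have mixed s t : Nk s -> Nn t -> 3 * bg <= dist s t by move=> Nks /Nn_far; apply.
have sep t t' r r' : roots t r -> roots t' r' -> r <> r' -> radius t + radius t' + 20 <= dist r r'.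
  case: t; case: t'; rewrite /roots /radius => rtr rtr' neq.
  - by have := Nk_sep _ _ rtr rtr' neq; lia.
  - by have := mixed _ _ rtr rtr'; lia.
  - by have := mixed _ _ rtr' rtr; rewrite dist_sym //; lia.
  - by have := Nn_sep _ _ rtr rtr' neq; lia.
split; unshelve refine
  (@Nets Y Delta roots radius offset level m
     sep _ level_at level_le _ level_lt _ _ _ _ _ _ _) => //.
- move=> t t' r; case: t; case: t' => //= r1 r2; exfalso.
  + by have := mixed _ _ r1 r2; rewrite dist0; lia.
  + by have := mixed _ _ r2 r1; rewrite dist0; lia.
- by move=> t r w _ e; have := level_lt w; rewrite e /offset /radius; case: t {e} => /=; lia.
- move=> t r w rtr le_w.
  have [t' [r' rtr' e]] := level_at w; rewrite e.
  have := level_le _ _ w rtr; rewrite e.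
  have [eqr|neq] := pselect (r = r').
    rewrite -{}eqr in rtr' *.
    suff -> : t = t' by [].
    case: t t' rtr rtr' {le_w e} => -[] //= r1 r2; exfalso.
      by have := mixed _ _ r1 r2; rewrite dist0; lia.
    by have := mixed _ _ r2 r1; rewrite dist0; lia.
  have := dist_tri Yconn r w r'; rewrite [dist r w]dist_sym //.
  case: t rtr le_w; case: t' rtr' {e}; rewrite /roots /radius /offset => rtr' rtr le_w.
  - by have := Nk_sep _ _ rtr rtr' neq; lia.
  - by have := mixed _ _ rtr rtr'; lia.
  - by have := mixed _ _ rtr' rtr; rewrite dist_sym //; lia.
  - by have := Nn_sep _ _ rtr rtr' neq; lia.
- by case; rewrite /radius; lia.
- move=> r /= rtr; rewrite ltnNge; apply/negP => thick.
  have [s Nks lt_s] := Nk_max r thick.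
  by have := mixed _ _ Nks rtr; lia.
- by rewrite /radius /sm /a; lia.
Qed.

End NetsExist.

(** * The base coloring *)

Section BaseColoring.
Variables (Y : ggraph) (Delta : nat).
Hypothesis Yconn : connected_graph Y.
Hypothesis Ydeg : forall u : Y, degree u <= Delta.
Hypothesis Yinf : infinite_set [set: Y]%classic.
Variable N : nets Y Delta.
Implicit Types (t : bool) (r u v w p : Y).

Local Notation root := (roots N).
Local Notation rad := (radius N).
Local Notation lv := (level N).

Definition is_root v := exists t, root t v.

Lemma near_unique t t' r r' v : root t r -> root t' r' ->
  dist r v <= rad t -> dist r' v <= rad t' + 15 -> r = r' /\ t = t'.
Proof.
move=> rtr rtr' le_r le_r'.
have [eqr|neq] := pselect (r = r'); last first.
  have := roots_sep rtr rtr' neq; have := dist_tri Yconn r v r'.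
  rewrite [dist v r']dist_sym //; lia.
by rewrite -eqr in rtr' *; split=> //; apply: roots_type rtr rtr'.
Qed.

Lemma level_root_dist t r v : root t r -> dist r v <= rad t + 1 ->
  lv v = offset N t + dist r v.
Proof. by move=> rtr rv; rewrite (level_near rtr) dist_sym. Qed.

Lemma level_adj u v : adj u v -> lv v <= lv u + 1.
Proof.
move=> uv; have [t [r rtr ->]] := level_attained N u.
apply: leq_trans (level_le v rtr) _; rewrite -addnA leq_add2l.
by rewrite ![dist _ r]dist_sym //; apply: dist_adj.
Qed.

(** The distance from a root to its marker tells thick from thin. *)
Definition marker_dist t := if t then 3 else 4.

(** The flag, the marker and the beacon of a root.  The flag z is a zero next to
    the root r, and the marker g lies on a geodesic starting with r and z: being
    closer to z than to r, it tells which of the two zeros is the root. *)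
Lemma marks_exist (tr : bool * Y) : exists zge : Y * Y * Y,
  [/\ adj tr.2 zge.1.1, dist tr.2 zge.1.2 = marker_dist tr.1,
      dist zge.1.1 zge.1.2 = (marker_dist tr.1).-1 & dist tr.2 zge.2 = 6].
Proof.
case: tr => t r /=; have [e re] := sphere_neq0 Yconn Yinf r 6.
have [z rz ze] := dist_step Yconn re.
have [g zg ge] : exists2 g, dist z g = (marker_dist t).-1 &
    dist g e = dist z e - (marker_dist t).-1.
  by apply: dist_between => //; rewrite ze /marker_dist; case: t.
exists (z, g, e); split=> //=; apply/eqP; rewrite eqn_leq.
have := dist_tri Yconn r z g; have := dist_tri Yconn r g e.
rewrite re ge zg ze (adj_dist Yconn rz) /marker_dist; case: t {zg ge}; lia.
Qed.

Definition flag t r := (projT1 (cid (marks_exist (t, r)))).1.1.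
Definition marker t r := (projT1 (cid (marks_exist (t, r)))).1.2.
Definition beacon t r := (projT1 (cid (marks_exist (t, r)))).2.

Lemma marksP t r : [/\ adj r (flag t r), dist r (marker t r) = marker_dist t,
  dist (flag t r) (marker t r) = (marker_dist t).-1 & dist r (beacon t r) = 6].
Proof. exact: projT2 (cid (marks_exist (t, r))). Qed.

Definition slot t r : set Y := projT1 (cid (maximal_separated Yconn
  [set v | 10 <= dist r v <= rad t]%classic (isT : 0 < 3))).

Lemma slotP t r : [/\ forall v, slot t r v -> 10 <= dist r v <= rad t,
   forall v w, slot t r v -> slot t r w -> v <> w -> 3 <= dist v w &
   forall v, 10 <= dist r v <= rad t -> exists2 s, slot t r s & dist s v < 3].
Proof. exact: projT2 (cid (maximal_separated Yconn _ _)). Qed.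

Definition special t r v := [\/ v = flag t r, v = marker t r, v = beacon t r | slot t r v].

Lemma dist_flag t r : dist r (flag t r) = 1.
Proof. by case: (marksP t r) => /(adj_dist Yconn). Qed.
Lemma dist_marker t r : dist r (marker t r) = marker_dist t. Proof. by case: (marksP t r). Qed.
Lemma dist_flag_marker t r : dist (flag t r) (marker t r) = (marker_dist t).-1.
Proof. by case: (marksP t r). Qed.
Lemma dist_beacon t r : dist r (beacon t r) = 6. Proof. by case: (marksP t r). Qed.
Lemma dist_slot t r v : slot t r v -> 10 <= dist r v <= rad t.
Proof. by case: (slotP t r) => h _ _; apply: h. Qed.

Lemma special_dist t r v : special t r v -> 1 <= dist r v <= rad t.
Proof.
have r20 := radius_ge20 N t; case=> [->|->|->|/dist_slot].
- by rewrite dist_flag; lia.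
- by rewrite dist_marker /marker_dist; case: ifP; lia.
- by rewrite dist_beacon; lia.
- lia.
Qed.

Lemma special_inj t r v w : special t r v -> special t r w ->
  dist r v = dist r w -> dist v w <= 2 -> v = w.
Proof.
have md34 : 3 <= marker_dist t <= 4 by rewrite /marker_dist; case: t.
case=> [->|->|->|sv]; case=> [->|->|->|sw] //.
all: rewrite ?dist_flag ?dist_marker ?dist_beacon; try (move=> *; lia).
all: try (have := dist_slot sw; lia).
all: try (have := dist_slot sv; lia).
move=> _ le2; apply: contrapT => neq.
by case: (slotP t r) => _ /(_ _ _ sv sw neq); lia.
Qed.

(** The vertices that may get color 0 without being roots. *)
Definition specials v := exists t r, root t r /\ special t r v.

(** Siblings have the same level and are at distance at most 2, so at most one
    child in each family is special. *)
Lemma specials_inj v w : specials v -> specials w -> lv v = lv w ->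
  dist v w <= 2 -> v = w.
Proof.
move=> [t [r [rtr sv]]] [t' [r' [rtr' sw]]] eql vw.
have /andP[_ rv] := special_dist sv; have /andP[_ rw] := special_dist sw.
have [] := near_unique rtr rtr' rv.
  by have := dist_tri Yconn r' w v; rewrite [dist w v]dist_sym //; lia.
move=> ? ?; subst r' t'; apply: special_inj sv sw _ vw.
by move: eql; rewrite !(level_root_dist rtr) ?(leq_trans _ (leq_addr _ _)) //; lia.
Qed.

Lemma special_not_root t r v : root t r -> special t r v -> ~ is_root v.
Proof.
move=> rtr /special_dist/andP[rv le_r] [t' rtv].
have [|eqr _] := near_unique rtr rtv le_r; first by rewrite dist0.
by move: rv; rewrite eqr dist0.
Qed.

Lemma specials_not_root v : specials v -> ~ is_root v.
Proof. by move=> [t [r [rtr /special_not_root]]]; apply. Qed.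

Definition lower v : set Y := [set u | adj v u /\ lv u + 1 = lv v]%classic.

Lemma lower_exists v : ~ is_root v -> exists u, lower v u.
Proof.
move=> nr; have [t [r rtr e]] := level_attained N v.
case d_v: (dist v r) => [|n].
  by case: nr; exists t; rewrite (dist_eq0 Yconn d_v).
have [w vw wr] := dist_step Yconn d_v.
exists w; split=> //; have := level_le w rtr.
have := level_adj (u := w) (v := v); rewrite adj_sym => /(_ vw).
by rewrite wr; lia.
Qed.

(** [xget] makes the parent depend on the set of lower neighbors alone. *)
Definition parent v := xget v (lower v).

Lemma parent_lower v : ~ is_root v -> lower v (parent v).
Proof. by move=> /lower_exists[u lu]; apply: xgetI lu. Qed.

Lemma parent_eq v w : ~ is_root v -> lower v = lower w -> parent v = parent w.
Proof.
move=> /lower_exists[u lu]; rewrite /parent => eql; rewrite -eql /xget.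
by case: pselect => // nex; case: nex; exists u; apply/asboolP.
Qed.

Definition children u := [seq v <- enum_fset (neighbors u) | `[< ~ is_root v /\ parent v = u >]].

Lemma in_children u v : (v \in children u) = `[< ~ is_root v /\ parent v = u >].
Proof.
rewrite mem_filter; case: asboolP => //= -[nr <-].
by have [vp _] := parent_lower nr; rewrite [LHS](in_neighbors (parent v) v) adj_sym.
Qed.

Lemma childrenP v : ~ is_root v -> v \in children (parent v).
Proof. by move=> nr; rewrite in_children; apply/asboolP. Qed.

Lemma siblings_near v w : ~ is_root v -> ~ is_root w -> parent v = parent w ->
  lv v = lv w /\ dist v w <= 2.
Proof.
move=> nv nw e; have [vp lp] := parent_lower nv; have [wp lp'] := parent_lower nw.
split; first by rewrite -lp -lp' e.
have := dist_tri Yconn v (parent v) w; rewrite (adj_dist Yconn vp).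
by rewrite e [dist (parent w) w]dist_sym // (adj_dist Yconn wp).
Qed.

Lemma size_children u : size (children u) <= Delta.
Proof.
by apply: leq_trans (Ydeg u); rewrite size_filter count_size.
Qed.

(** A vertex that is not a root has a lower neighbor, which is not a child. *)
Lemma size_children_nonroot u : ~ is_root u -> size (children u) < Delta.
Proof.
move=> nu; apply: leq_trans (Ydeg u).
have [p [up lp]] := lower_exists nu.
rewrite size_filter ltn_neqAle count_size andbT -all_count.
apply/negP => /allP/(_ p); rewrite [p \in _](in_neighbors u p) up => /(_ isT)/asboolP[np pu].
by have [_] := parent_lower np; rewrite pu; lia.
Qed.

(** The special child comes first: it gets index 0. *)
Definition ordered_children u :=
  [seq v <- children u | `[< specials v >]] ++
  [seq v <- children u | ~~ `[< specials v >]].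

Definition child_index v := index v (ordered_children (parent v)).

Lemma perm_ordered_children u : perm_eq (ordered_children u) (children u).
Proof. exact/permEl/(perm_filterC (fun v => `[< specials v >])). Qed.

Lemma child_index_lt v : ~ is_root v -> child_index v < size (children (parent v)).
Proof.
move=> nr; rewrite -(perm_size (perm_ordered_children _)) index_mem.
by rewrite (perm_mem (perm_ordered_children _)) childrenP.
Qed.

Lemma child_index_inj v w : ~ is_root v -> ~ is_root w -> parent v = parent w ->
  child_index v = child_index w -> v = w.
Proof.
move=> nv nw e; rewrite /child_index e => ei.
have inO u : ~ is_root u -> u \in ordered_children (parent u).
  by move=> nu; rewrite (perm_mem (perm_ordered_children _)) childrenP.
by rewrite -(nth_index v (inO w nw)) -ei nth_index // -e inO.
Qed.

Lemma child_index_special v : specials v -> child_index v = 0.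
Proof.
move=> sv; have nv := specials_not_root sv.
have vs : v \in [seq w <- children (parent v) | `[< specials w >]].
  by rewrite mem_filter childrenP // andbT; apply/asboolP.
rewrite /child_index /ordered_children; case E: [seq w <- _ | `[< _ >]] vs => [//|x s] _.
have : x \in [seq w <- children (parent v) | `[< specials w >]] by rewrite E mem_head.
rewrite mem_filter in_children => /andP[/asboolP sx /asboolP[nx ex]] /=.
have [el dl] := siblings_near nx nv ex.
by rewrite (specials_inj sx sv el dl) eqxx.
Qed.

Definition is_marker v := exists t r, root t r /\ v = marker t r.

(** Under a root the colors of the children start at 0, the color of the flag;
    elsewhere they start at 1, so that special children other than markers have
    color 1 and can be switched to 0. *)
Definition chi v : nat :=
  if `[< is_root v \/ is_marker v >] then 0
  else child_index v + ~~ `[< is_root (parent v) >].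

(** Colors start at 1 only in families of at most Delta - 1 children. *)
Lemma chi_lt v : chi v < Delta.
Proof.
rewrite /chi; case: asboolP => [_|/not_orP[nv _]].
  by have := two_le_max_degree Yconn Ydeg Yinf; lia.
have lt_i := child_index_lt nv.
case: asboolP => [_|/size_children_nonroot] /=.
  by rewrite addn0 (leq_trans lt_i) ?size_children.
by move: lt_i; lia.
Qed.

Lemma parent_flag t r : root t r -> parent (flag t r) = r.
Proof.
move=> rtr; have sz : special t r (flag t r) by apply: Or41.
have [zp lp] := parent_lower (special_not_root rtr sz).
have r20 := radius_ge20 N t.
have dzp := dist_adj Yconn r zp; rewrite dist_flag in dzp.
have lz : lv (flag t r) = offset N t + 1 by rewrite (level_root_dist rtr) dist_flag //; lia.
have lp' : lv (parent (flag t r)) = offset N t + dist r (parent (flag t r)).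
  by apply: level_root_dist => //; lia.
by rewrite -(dist_eq0 Yconn (u := r) (v := parent (flag t r))) //; lia.
Qed.

Lemma chi_root v : is_root v -> chi v = 0.
Proof. by move=> rv; rewrite /chi asboolT //; left. Qed.

Lemma chi_marker t r : root t r -> chi (marker t r) = 0.
Proof. by move=> rtr; rewrite /chi asboolT //; right; exists t; exists r. Qed.

Lemma chi_flag t r : root t r -> chi (flag t r) = 0.
Proof.
move=> rtr; rewrite /chi; case: asboolP => // _.
rewrite child_index_special; last by exists t; exists r; split=> //; apply: Or41.
by rewrite parent_flag // asboolT //; exists t.
Qed.

Lemma chi_zero v : chi v = 0 ->
  is_root v \/ exists t r, root t r /\ (v = flag t r \/ v = marker t r).
Proof.
rewrite /chi; case: asboolP => [[rv _|[t [r [rtr ->]]] _]|/not_orP[nv _]].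
- by left.
- by right; exists t; exists r; split=> //; right.
case: asboolP => //= [[t rtr]|_]; last by rewrite addn1.
rewrite addn0 => iv0; right; exists t; exists (parent v); split=> //; left.
have sz : specials (flag t (parent v)) by exists t; exists (parent v); split=> //; apply: Or41.
apply: child_index_inj => //; first exact: specials_not_root.
  by rewrite parent_flag.
by rewrite iv0 child_index_special.
Qed.

Definition toggle v := exists t r, root t r /\ (v = beacon t r \/ slot t r v).

Lemma far_special_chi t r v : root t r -> special t r v -> 6 <= dist r v -> chi v = 1.
Proof.
move=> rtr sv v6; have nv := special_not_root rtr sv.
have [vp _] := parent_lower nv; have /andP[_ rv] := special_dist sv.
have rp : dist r (parent v) <= rad t + 1 by have := dist_adj Yconn r vp; lia.
have rp5 : 5 <= dist r (parent v).
  by rewrite adj_sym in vp; have := dist_adj Yconn r vp; lia.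
rewrite /chi; case: asboolP => [[//|[t' [r' [rtr' ev]]]]|_].
  have := radius_ge20 N t'; have [|? ?] := near_unique rtr rtr' rv.
    by rewrite ev dist_marker /marker_dist; case: (t'); lia.
  by subst; move: v6; rewrite dist_marker /marker_dist; case: (t'); lia.
rewrite child_index_special ?add0n; last by exists t; exists r.
case: asboolP => // -[t' rtp].
have [e|neq] := pselect (r = parent v); first by move: rp5; rewrite -e dist0.
by have := roots_sep rtr rtp neq; have := radius_ge20 N t'; lia.
Qed.

Lemma toggle_special v : toggle v -> exists t r, [/\ root t r, special t r v & 6 <= dist r v].
Proof.
move=> [t [r [rtr [->|sv]]]]; exists t; exists r.
  by split=> //; [apply: Or43|rewrite dist_beacon].
by split=> //; [apply: Or44|have := dist_slot sv; lia].
Qed.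

Lemma toggle_chi v : toggle v -> chi v = 1.
Proof. by move=> /toggle_special[t [r [rtr sv v6]]]; exact: (far_special_chi rtr sv v6). Qed.

(** The same lower neighbors give the same parent, and siblings have distinct
    colors. *)
Lemma chi_determined v w : ~ is_root v -> ~ is_root w -> lower v = lower w ->
  chi v = chi w -> v = w.
Proof.
move=> nv nw el ec; have ep := parent_eq nv el.
have [elv dvw] := siblings_near nv nw ep.
have zero_special u : ~ is_root u -> chi u = 0 -> specials u.
  move=> nu /chi_zero[//|[t [r [rtr zg]]]]; exists t; exists r; split=> //.
  by case: zg => ->; [apply: Or41|apply: Or42].
case c0: (chi v) => [|n].
  by apply: specials_inj => //; apply: zero_special => //; rewrite -ec.
move: ec c0; rewrite /chi; case: asboolP => // _.
case: (asboolP (is_root w \/ is_marker w)) => [_ -> //|nw'].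
rewrite -ep => /eqP; rewrite eqn_add2r => /eqP ei _; exact: child_index_inj.
Qed.
End BaseColoring.

(** * Recognizing the roots from the colors *)

Section Recognition.
Variables (Y : ggraph) (Delta : nat).
Hypothesis Yconn : connected_graph Y.
Hypothesis Ydeg : forall u : Y, degree u <= Delta.
Hypothesis Yinf : infinite_set [set: Y]%classic.
Variable N : nets Y Delta.
Implicit Types (t : bool) (r u v w p : Y) (kappa : Y -> nat).

Local Notation root := (roots N).
Local Notation rad := (radius N).
Local Notation lv := (level N).
Local Notation flag := (flag Yconn Yinf).
Local Notation marker := (marker Yconn Yinf).
Local Notation beacon := (beacon Yconn Yinf).
Local Notation slot := (slot Yconn N).
Local Notation special := (special Yconn Yinf N).
Local Notation chi := (chi Yconn Yinf N).
Local Notation toggle := (toggle Yconn Yinf N).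

Lemma rad_le t : rad t <= rad true.
Proof. by have := radius_ratio N; case: t => //; lia. Qed.

(** The colorings obtained from chi by writing bits. *)
Definition tinted kappa := forall v, kappa v = chi v \/ toggle v /\ kappa v = 0.

Lemma tinted_zero_on kappa (X : set Y) x : (X `<=` toggle)%classic ->
  tinted kappa -> tinted (zero_on kappa X x).
Proof.
move=> Xt tk v; rewrite /zero_on.
by case: asboolP => //= Xv; case: (x v) => //; right; split=> //; apply: Xt.
Qed.

Lemma tinted_chi : tinted chi. Proof. by left. Qed.

Lemma tinted_site kappa v : tinted kappa -> kappa v = 0 ->
  exists t r, root t r /\ (v = r \/ special t r v).
Proof.
move=> /(_ v)[-> /chi_zero|[+ _] _].
  case=> [[t rtv]|[t [r [rtr zg]]]]; first by exists t; exists v; split=> //; left.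
  exists t; exists r; split=> //; right.
  by case: zg => ->; [apply: Or41|apply: Or42].
by move=> /toggle_special[t [r [rtr sv _]]]; exists t; exists r; split=> //; right.
Qed.

Lemma tinted_zero kappa v : tinted kappa -> chi v = 0 -> kappa v = 0.
Proof. by move=> /(_ v)[->|[]]. Qed.

Lemma site_dist t r v : v = r \/ special t r v -> dist r v <= rad t.
Proof. by case=> [->|/special_dist/andP[]//]; rewrite dist0. Qed.

Lemma special_cases t r v : special t r v ->
  [\/ v = flag t r /\ dist r v = 1, v = marker t r /\ dist r v = marker_dist t,
      dist r v = 6 | slot t r v /\ 10 <= dist r v].
Proof.
case=> [->|->|->|sv].
- by apply: Or41; rewrite dist_flag.
- by apply: Or42; rewrite dist_marker.
- by apply: Or43; rewrite dist_beacon.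
- by apply: Or44; have := dist_slot sv; split=> //; lia.
Qed.

(** Toggles are far apart and far from the marks of roots, so the only edges
    between zeros are those from a root to its flag. *)
Lemma adjacent_zeros kappa v w : tinted kappa -> kappa v = 0 -> kappa w = 0 ->
  adj v w -> exists t r, root t r /\ (v = r /\ w = flag t r \/ v = flag t r /\ w = r).
Proof.
move=> tk kv kw vw.
have [t [r [rtr sv]]] := tinted_site tk kv.
have [t' [r' [rtr' sw]]] := tinted_site tk kw.
have dvw := adj_dist Yconn vw.
have [] := near_unique Yconn rtr rtr' (site_dist sv).
  have := site_dist sw; have := dist_tri Yconn r' w v.
  by rewrite [dist w v]dist_sym // dvw; lia.
move=> ? ?; subst r' t'; exists t; exists r; split=> //.
have rw := dist_adj Yconn r vw.
have rv : dist r v <= dist r w + 1 by rewrite adj_sym in vw; apply: dist_adj.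
have md34 : 3 <= marker_dist t <= 4 by rewrite /marker_dist; case: (t).
case: sv => [ev|sv].
  rewrite ev dist0 in rw; left; split=> //.
  case: sw => [ew|/special_cases[[]|[_]||[_]]] //; try lia.
  by rewrite ev ew adj_irr in vw.
case: sw => [ew|sw].
  rewrite ew dist0 in rv; right; split=> //.
  by case/special_cases: sv => [[]|[_]||[_]] //; lia.
case: (eqVneq (dist r v) (dist r w)) => [e|ne].
  by move: vw; rewrite (special_inj sv sw e) ?adj_irr // dvw.
exfalso; have := special_cases sv; have := special_cases sw.
case=> [[_ dw]|[_ dw]|dw|[slw dw]]; case=> [[_ dv]|[_ dv]|dv|[slv dv]]; try lia.
have [_ sep _] := slotP Yconn N t r; have := sep v w slv slw; rewrite dvw.
by move=> h; have : 3 <= 1 by apply: h => e; move: vw; rewrite e adj_irr.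
Qed.

Definition pattern kappa t r := kappa r = 0 /\ exists z g,
  [/\ adj r z, kappa z = 0, kappa g = 0, dist r g = marker_dist t & dist z g = (marker_dist t).-1].

(** The marker is closer to the flag than to the root, which rules out the
    pattern with root and flag exchanged. *)
Lemma root_pattern kappa t r : tinted kappa -> root t r <-> pattern kappa t r.
Proof.
move=> tk; split=> [rtr|[kr [z [g [rz kz kg rg zg]]]]].
  split; first by apply: tinted_zero => //; apply: chi_root; exists t.
  exists (flag t r); exists (marker t r); rewrite dist_marker dist_flag_marker; split=> //.
  - by case: (marksP Yconn Yinf t r).
  - by apply: tinted_zero => //; apply: chi_flag.
  - by apply: tinted_zero => //; apply: chi_marker.
have [t1 [r1 [rtr1 cases]]] := adjacent_zeros tk kr kz rz.
have [t2 [r2 [rtr2 sg]]] := tinted_site tk kg.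
have md34 s : 3 <= marker_dist s <= 4 by rewrite /marker_dist; case: s.
have r1r : dist r1 r <= 1.
  by case: cases => -[-> _]; rewrite ?dist0 // dist_flag.
have [] := near_unique Yconn rtr2 rtr1 (site_dist sg).
  by have := dist_tri Yconn r1 r g; have := md34 t; lia.
move=> ? ?; subst r2 t2.
have kt := md34 t; have kt1 := md34 t1.
case: cases => -[er ez]; subst r z.
  have gk : dist r1 g = marker_dist t1.
    case: sg => [eg|/special_cases[[_ dg]|[_ dg]|dg|[_ dg]]]; try lia.
    by move: rg; rewrite eg dist0; lia.
  have : marker_dist t = marker_dist t1 by rewrite -rg gk.
  by rewrite /marker_dist; case: (t) rtr1; case: (t1).
exfalso; case: sg => [eg|/special_cases[[_ dg]|[eg dg]|dg|[_ dg]]]; try lia.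
  by move: zg; rewrite eg dist0; lia.
by move: rg; rewrite eg dist_flag_marker; lia.
Qed.

Definition root_at v n := exists t r, root t r /\ dist v r = n.

(** Erasing the bits: a zero comes from a bit exactly if it is far from all
    roots.  Hence isomorphisms that preserve the colors preserve chi. *)
Lemma chi_of_tint kappa v : tinted kappa -> chi v =
  if kappa v != 0 then kappa v else ~~ `[< exists2 n, n <= 4 & root_at v n >] : nat.
Proof.
move=> tk; case: eqP => [k0|kn] /=; last by case: (tk v) => [->|[_]].
have md34 s : 3 <= marker_dist s <= 4 by rewrite /marker_dist; case: s.
have [c0|c0] := eqVneq (chi v) 0.
  rewrite c0; case: asboolP => // -[].
  case: (chi_zero c0) => [[t rtv]|[t [r [rtr zg]]]].
    by exists 0 => //; exists t; exists v; rewrite dist0.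
  exists (dist v r); last by exists t; exists r.
  rewrite dist_sym //; case: zg => ->; first by rewrite dist_flag.
  by rewrite dist_marker; case/andP: (md34 t).
have [e|[tv _]] := tk v; first by rewrite -e k0 in c0.
rewrite toggle_chi //; case: asboolP => // -[n n4 [t' [r' [rtr' vr']]]].
have [t [r [rtr sv v6]]] := toggle_special tv.
have /andP[_ rv] := special_dist sv.
have [] := near_unique Yconn rtr rtr' rv; first by rewrite dist_sym // vr'; lia.
by move=> e _; move: v6; rewrite e dist_sym // vr'; lia.
Qed.

Section Invariance.
Variables (kappa : Y -> nat) (R : nat).
Hypothesis tk : tinted kappa.

Lemma root_fwd u v f t w : piso kappa kappa u v R f -> dist u w + 5 <= R ->
  root t w -> root t (f w).
Proof.
move=> isof wR /(root_pattern t w tk)[kw [z [g [wz kz kg wg zg]]]].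
have md34 : 3 <= marker_dist t <= 4 by rewrite /marker_dist; case: (t).
apply/(root_pattern t (f w) tk).
have uz := dist_adj Yconn u wz.
have ug : dist u g <= dist u w + 4 by have := dist_tri Yconn u w g; lia.
split; first by rewrite (piso_color isof) //; lia.
exists (f z); exists (f g); split.
- by rewrite (piso_adj isof) //; lia.
- by rewrite (piso_color isof) //; lia.
- by rewrite (piso_color isof) //; lia.
- by rewrite (piso_dist Yconn Yconn isof) //; lia.
- by rewrite (piso_dist Yconn Yconn isof) //; lia.
Qed.

Lemma root_bwd u v f t w : piso kappa kappa u v R f -> dist u w + 5 <= R ->
  root t (f w) -> root t w.
Proof.
move=> isof wR rfw; have [g [isog gf _]] := piso_sym isof.
have uw : dist u w <= R by lia.
by rewrite -(gf w uw); apply: root_fwd isog _ rfw; rewrite (piso_dist_center Yconn Yconn isof).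
Qed.

Lemma root_at_fwd u v f w n : piso kappa kappa u v R f -> dist u w + n + 5 <= R ->
  root_at w n -> root_at (f w) n.
Proof.
move=> isof wR [t [r [rtr wr]]]; exists t; exists (f r); split.
  by apply: root_fwd isof _ rtr; have := dist_tri Yconn u w r; lia.
by rewrite (piso_dist Yconn Yconn isof) // wr; lia.
Qed.

Lemma root_at_iff u v f w n : piso kappa kappa u v R f -> dist u w + n + 5 <= R ->
  root_at w n <-> root_at (f w) n.
Proof.
move=> isof wR; split; first exact: root_at_fwd isof wR.
have [g [isog gf _]] := piso_sym isof; have uw : dist u w <= R by lia.
rewrite -{2}(gf w uw); apply: root_at_fwd isog _.
by rewrite (piso_dist_center Yconn Yconn isof).
Qed.

Lemma chi_inv u v f w : piso kappa kappa u v R f -> dist u w + 9 <= R ->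
  chi (f w) = chi w.
Proof.
move=> isof wR; rewrite !(chi_of_tint _ tk) (piso_color isof); last by lia.
case: ifP => // _; congr (~~ _ : nat); apply/asboolP/asboolP => -[n n4 h]; exists n => //.
  by apply/(root_at_iff isof (n := n)) => //; lia.
by apply: root_at_fwd isof _ h; lia.
Qed.

Lemma level_le_fwd u v f w : piso kappa kappa u v R f ->
  dist u w + 3 * rad true + 6 <= R -> lv (f w) <= lv w.
Proof.
move=> isof wR; have [t [r rtr e]] := level_attained N w.
have lt_r := level_lt3 rtr e; have le_t := rad_le t; rewrite e.
rewrite -(piso_dist Yconn Yconn isof (w := w)); last by lia.
apply: level_le; apply: root_fwd isof _ rtr.
by have := dist_tri Yconn u w r; lia.
Qed.

Lemma level_inv u v f w : piso kappa kappa u v R f ->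
  dist u w + 3 * rad true + 6 <= R -> lv (f w) = lv w.
Proof.
move=> isof wR; apply/eqP; rewrite eqn_leq (level_le_fwd isof) //=.
have [g [isog gf _]] := piso_sym isof; have uw : dist u w <= R by lia.
rewrite -{1}(gf w uw); apply: level_le_fwd isog _.
by rewrite (piso_dist_center Yconn Yconn isof).
Qed.

End Invariance.
End Recognition.

(** * Telling nearby roots apart *)

Section Rigidity.
Variables (Y : ggraph) (Delta : nat).
Hypothesis Yconn : connected_graph Y.
Hypothesis Ydeg : forall u : Y, degree u <= Delta.
Hypothesis Yinf : infinite_set [set: Y]%classic.
Variable N : nets Y Delta.
Implicit Types (t : bool) (r u v w p : Y) (kappa : Y -> nat).

Local Notation root := (roots N).
Local Notation rad := (radius N).
Local Notation lv := (level N).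
Local Notation beacon := (beacon Yconn Yinf).
Local Notation slot := (slot Yconn N).
Local Notation chi := (chi Yconn Yinf N).
Local Notation toggle := (toggle Yconn Yinf N).
Local Notation tinted := (tinted Yconn Yinf N).

Lemma chi_inv_root_ball kappa t r r' f v : tinted kappa -> root t r -> root t r' ->
  piso kappa kappa r r' (rad t) f -> dist r v <= rad t -> chi (f v) = chi v.
Proof.
move=> tk rtr rtr' isof rv; rewrite !(chi_of_tint _ tk) (piso_color isof) //.
have r'v := piso_dist_center Yconn Yconn isof rv.
case: ifP => // _; congr (~~ _ : nat).
have near s x : root t s -> dist s x <= rad t ->
    `[< exists2 n, n <= 4 & root_at N x n >] = (dist s x <= 4).
  move=> rts sx; apply/asboolP/idP => [[n n4 [t' [s' [rts' xs']]]]|le4].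
    have [] := near_unique Yconn rts rts' sx; first by rewrite dist_sym // xs'; lia.
    by move=> -> _; rewrite dist_sym // xs'.
  by exists (dist s x) => //; exists t; exists s; rewrite [dist x s]dist_sym.
by rewrite (near r v) // (near r' (f v)) ?r'v //.
Qed.

(** Inside the ball of a root the levels are distances to the root, and
    [chi_determined] propagates agreement from each sphere to the next. *)
Lemma root_ball_unique kappa t r r' f f' : tinted kappa -> root t r -> root t r' ->
  piso kappa kappa r r' (rad t) f -> piso kappa kappa r r' (rad t) f' ->
  forall v, dist r v <= rad t -> f v = f' v.
Proof.
move=> tk rtr rtr' isof isof' v; move n_v: (dist r v) => n.
elim: n v n_v => [|n IHn] v n_v le_n.
  by rewrite -(dist_eq0 Yconn n_v) (piso_center isof) (piso_center isof').
have rv : dist r v <= rad t by rewrite n_v.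
have r20 := radius_ge20 N t.
have nonroot g : piso kappa kappa r r' (rad t) g -> ~ is_root N (g v).
  move=> isog [t' rtg]; have r'v := piso_dist_center Yconn Yconn isog rv.
  have [] := near_unique Yconn rtr' rtg (v := g v); rewrite ?r'v ?dist0 // => e _.
  by move: r'v; rewrite -e dist0 n_v.
have sub g h : piso kappa kappa r r' (rad t) g -> piso kappa kappa r r' (rad t) h ->
    (forall w, dist r w = n -> g w = h w) -> (lower N (g v) `<=` lower N (h v))%classic.
  move=> isog isoh gh p [gp lp].
  have r'gv := piso_dist_center Yconn Yconn isog rv.
  have r'hv := piso_dist_center Yconn Yconn isoh rv.
  have [g' [isog' g'g gg']] := piso_sym isog.
  have r'p := dist_adj Yconn r' gp.
  rewrite (level_root_dist Yconn rtr' (v := p)) in lp; last by lia.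
  rewrite (level_root_dist Yconn rtr' (v := g v)) in lp; last by lia.
  have r'pn : dist r' p = n by lia.
  have [rq gq] := gg' p (ltac:(lia)); rewrite -gq in r'pn gp *.
  have rqn : dist r (g' p) = n by rewrite -r'pn (piso_dist_center Yconn Yconn isog).
  rewrite (gh _ rqn); split.
    by rewrite (piso_adj isoh) // -(piso_adj isog).
  rewrite !(level_root_dist Yconn rtr') ?(piso_dist_center Yconn Yconn isoh) //; lia.
have IH w : dist r w = n -> f w = f' w by move=> rw; apply: IHn => //; apply: ltnW.
apply: (chi_determined (Yconn := Yconn) (Yinf := Yinf) (nonroot _ isof) (nonroot _ isof')).
- apply/seteqP; split; apply: sub => // w /IH //.
- by rewrite !(chi_inv_root_ball tk rtr rtr').
Qed.

Definition slots : set Y := [set v | exists t r, root t r /\ slot t r v]%classic.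
Definition beacons : set Y := [set v | exists t r, root t r /\ v = beacon t r]%classic.

Lemma slots_toggle : (slots `<=` toggle)%classic.
Proof. by move=> v [t [r [rtr sv]]]; exists t; exists r; split=> //; right. Qed.

Lemma beacons_toggle : (beacons `<=` toggle)%classic.
Proof. by move=> v [t [r [rtr ev]]]; exists t; exists r; split=> //; left. Qed.

Lemma card_slots t r (S : {fset Y}) : (forall v, slot t r v -> v \in S) ->
  #|` ball r (rad t)| <= #|` ball r 9| + #|` S| * Delta.+1 ^ 2.
Proof.
move=> slotS.
have le1 : #|` [fset v in ball r (rad t) | 9 < dist r v]%fset| <= #|` S| * Delta.+1 ^ 2.
  apply: card_cover => // v; rewrite in_fset_sep in_ball // => /andP[rv v9].
  have [_ _ /(_ v)] := slotP Yconn N t r; rewrite v9 rv => /(_ isT)[s ss sv].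
  by exists s; rewrite ?slotS.
apply: leq_trans (_ : #|` ball r 9| + _ <= _); last by rewrite leq_add2l; exact: le1.
rewrite -cardfsUI; apply: leq_trans (leq_addr _ _).
apply/fsubset_leq_card/fsubsetP => v; rewrite in_fsetU in_fset_sep !in_ball // => ->.
by rewrite leqNgt; case: (9 < _).
Qed.

Definition separates kappa := forall t r r' f, root t r -> root t r' -> r <> r' ->
  dist r r' <= 6 * rad t -> ~ piso kappa kappa r r' (rad t) f.

(** The isomorphism between the balls of two given roots r and r' is unique,
    whatever the bits, and the balls are disjoint: so the bits in the slots of r
    are determined by the colors around r'. *)
Lemma slot_bits_separate : exists y, separates (zero_on chi slots y).
Proof.
pose ty r := `[< root true r >].
pose valid (i : Y * Y) := [/\ root (ty i.1) i.1, root (ty i.1) i.2, i.1 <> i.2 &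
  dist i.1 i.2 <= 6 * rad (ty i.1)].
pose I := {i : Y * Y | `[< valid i >]}.
pose bad (i : I) y := let: (r, r') := val i in exists f,
  piso (zero_on chi slots y) (zero_on chi slots y) r r' (rad (ty r)) f.
pose supp (i : I) := let: (r, r') := val i in
  (ball r (rad (ty r)) `|` ball r' (rad (ty r)))%fset.
pose S (i : I) := let: (r, r') := val i in
  [fset v in ball r (rad (ty r)) | `[< slot (ty r) r v >]]%fset.
pose cls (i : I) := let: (r, r') := val i in if ty r then 1 else 0.
pose c j := if j == 0 then 2 * mass N else 14 * Delta * rad true.
have tint y : tinted (zero_on chi slots y).
  exact: tinted_zero_on slots_toggle (tinted_chi _ _ _).
have tyE t r : root t r -> ty r = t.
  move=> rtr; rewrite /ty; case: asboolP => [rT|nT]; first exact: roots_type rT rtr.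
  by case: t rtr nT.
have [||||||y yP] := @local_lemma Y I supp S bad cls c.
- case=> -[r r'] /= vi; rewrite /supp /=; apply/fset0Pn; exists r.
  by rewrite inE in_ball // dist0.
- case=> -[r r'] /= vi; rewrite /supp /S /=; apply/fsubsetP => v.
  by rewrite in_fset_sep in_fsetU => /andP[-> _].
- move=> i x x'; rewrite /supp /bad; case: (val i) => r r' xx' [f isof].
  have col a : a \in (ball r (rad (ty r)) `|` ball r' (rad (ty r)))%fset ->
      zero_on chi slots x a = zero_on chi slots x' a.
    by rewrite /zero_on => /xx' ->.
  exists f; apply: (piso_recolor isof) => a ua.
  rewrite -!col; first exact: (piso_color isof).
    by rewrite inE in_ball // ua.
  rewrite inE !in_ball //; apply/orP; right.
  by rewrite (piso_dist_center Yconn Yconn isof).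
- case=> -[r r'] /= vi x x'; have /asboolP[/= rtr rtr' neq dr] := vi.
  rewrite /bad /S /= => -[f isof] [f' isof'] outside s.
  rewrite in_fset_sep in_ball // => /andP[rs /asboolP ss].
  have sS : slots s by exists (ty r); exists r.
  have chi_iso y g : piso (zero_on chi slots y) (zero_on chi slots y) r r' (rad (ty r)) g ->
      piso chi chi r r' (rad (ty r)) g.
    by move=> isog; apply: (piso_recolor isog) => a ra; apply: chi_inv_root_ball isog ra.
  have eqf : f s = f' s.
    apply: (root_ball_unique (tinted_chi _ _ _) rtr rtr') rs.
      exact: chi_iso isof.
    exact: chi_iso isof'.
  have zeroE y g : piso (zero_on chi slots y) (zero_on chi slots y) r r' (rad (ty r)) g ->
      y s = (zero_on chi slots y (g s) == 0).
    move=> isog; rewrite (piso_color isog) // /zero_on asboolT //=.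
    by case: (y s) => //; rewrite toggle_chi //; apply: slots_toggle.
  rewrite (zeroE _ _ isof) (zeroE _ _ isof') eqf /zero_on outside // in_fset_sep in_ball //.
  apply/negP => /andP[rfs _]; have r'fs := piso_dist_center Yconn Yconn isof' rs.
  by have [|e _] := near_unique Yconn rtr rtr' rfs; [lia|case: neq].
- case=> -[r r'] /= vi; have /asboolP[/= rtr _ _ _] := vi.
  have := @card_slots (ty r) r (S (exist _ (r, r') vi)).
  rewrite {1}/S /= => /(_ _)/wrap[].
    move=> v sv; rewrite in_fset_sep in_ball //; apply/andP; split; last exact/asboolP.
    by case/andP: (dist_slot sv).
  set s := #|` S _|; rewrite /cls /=; have b2 : 0 < Delta.+1 ^ 2 by rewrite expn_gt0.
  case T: (ty r) rtr => rtr; rewrite /c /= => le_s.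
    have : Delta.+1 ^ 2 * (28 * Delta * rad true + 9) <= Delta.+1 ^ 2 * s.
      have := thick_capacity N; have := roots_thick rtr; have := card_ball Ydeg r 9.
      move: le_s; move: #|` ball r _| #|` ball r 9| (_ ^ 2) (_ ^ 9) (2 ^ _) s => *.
      lia.
    by rewrite leq_pmul2l //; clear; lia.
  have : Delta.+1 ^ 2 * (4 * mass N + 7) <= Delta.+1 ^ 2 * s.
    have := thin_capacity N; have := card_ball_add Yconn Yinf r 9 (rad false - 9).
    rewrite subnKC; last by have := radius_ge20 N false; lia.
    move: le_s; move: #|` ball r (rad false)| #|` ball r 9| => *; lia.
  by rewrite leq_pmul2l //; clear; lia.
- move=> w j l ul lP; case l0: l => [//|i0 l']; rewrite -l0.
  have il0 : i0 \in l by rewrite l0 mem_head.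
  have pairs_le (B : {fset Y}) :
      (forall i, i \in l -> (val i).1 \in B /\ (val i).2 \in B) -> size l <= #|` B| * #|` B|.
    by apply: size_pairs_le => // i i' _ _ /val_inj.
  have info i : i \in l -> [/\ root (ty (val i).1) (val i).1,
      (if ty (val i).1 then 1 else 0) = j, dist w (val i).1 <= 7 * rad (ty (val i).1) &
      dist w (val i).2 <= 7 * rad (ty (val i).1)].
    case/lP; case: i => -[r r'] /= vi; rewrite /cls /supp /= => <-.
    have /asboolP[/= rtr _ _ dr] := vi; rewrite in_fsetU !in_ball // ![dist w _]dist_sym //.
    have := dist_tri Yconn r r' w; have := dist_tri Yconn r' r w.
    rewrite [dist r' r]dist_sym // => h1 h2 h3; split=> //; move: h1 h2 h3 dr; clear; lia.
  have [root0 cls0 near0 _] := info i0 il0.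
  case T0: (ty (val i0).1) cls0 root0 near0 => <- root0 near0 in info *.
    apply: leq_trans (pairs_le (ball w (7 * rad true)) _) _.
      move=> i il; have [_ clsi near1 near2] := info i il.
      by move: clsi near1 near2; rewrite !in_ball //; case: (ty _).
    have leB := card_ball Ydeg w (7 * rad true).
    apply: leq_trans (leq_mul leB leB) _; rewrite -expnD /c /=.
    have -> : 14 * Delta * rad true = Delta * (7 * rad true + 7 * rad true) by clear; lia.
    rewrite expnM; case: (_ + _) => // n; rewrite leq_exp2r //; exact: ltn_expl.
  rewrite /c /= mul2n -addnn expnD.
  apply: leq_trans (pairs_le (ball (val i0).1 (rad true)) _) _; last first.
    by apply: leq_mul; apply: ltnW; apply: roots_thin.
  move=> i il; have [_ clsi near1 near2] := info i il.
  have := dist_tri Yconn (val i0).1 w (val i).1; have := dist_tri Yconn (val i0).1 w (val i).2.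
  have := radius_ratio N; rewrite !in_ball // [dist _ w]dist_sym //.
  move: clsi near1 near2 near0; case: (ty _) => // _ reach n2 n0 ratio t2 t1.
  have le14 : 7 * rad false + 7 * rad false <= rad true by rewrite -mulnDl.
  by split; [apply: leq_trans t1 _|apply: leq_trans t2 _]; apply: leq_trans (leq_add n0 _) le14.
exists y => t r r' f rtr rtr' neq dr isof.
have vi : `[< valid (r, r') >] by apply/asboolP; rewrite /valid /= (tyE _ _ rtr).
by apply: (yP (exist _ (r, r') vi)); exists f; rewrite (tyE _ _ rtr).
Qed.

End Rigidity.

(** * Rigidity *)

Section RigidColoring.
Variables (Y : ggraph) (Delta : nat).
Hypothesis Yconn : connected_graph Y.
Hypothesis Ydeg : forall u : Y, degree u <= Delta.
Hypothesis Yinf : infinite_set [set: Y]%classic.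
Variable N : nets Y Delta.
Implicit Types (t : bool) (r u v w p q : Y) (kappa : Y -> nat).

Local Notation root := (roots N).
Local Notation rad := (radius N).
Local Notation lv := (level N).
Local Notation chi := (chi Yconn Yinf N).
Local Notation tinted := (tinted Yconn Yinf N).
Local Notation beacons := (beacons Yconn Yinf N).
Local Notation slots := (slots Yconn N).

(** Let w' be a neighbor of w.  The induction on the level runs over all the
    vertices q on descending paths from w'.  If q is a root, its two images are
    at distance at most six radii because q is within three radii of w, and
    their balls are isomorphic: they are equal. *)
Lemma separates_rigid kappa : tinted kappa -> separates N kappa ->
  rigid kappa (7 * rad true + 30).
Proof.
move=> tk sep u v v' R f f' w w' isof isof' wR fw ww'.
have ww'1 := dist_adj Yconn u ww'.
suff main q : dist w' q + lv q <= lv w' -> f q = f' q.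
  by apply: main; rewrite dist0.
move n_q: (lv q) => n; elim/ltn_ind: n q n_q => n IHn q n_q le_q.
have lt_w' := level_bound N w'.
have w'q : dist w' q < 3 * rad true by lia.
have uq : dist u q <= dist u w + 1 + 3 * rad true.
  by have := dist_tri Yconn u w' q; lia.
have [rtq|nq] := pselect (is_root N q).
  have [t rt_q] := rtq; apply: contrapT => neq.
  have lq : lv q = offset N t by rewrite (level_root_dist Yconn rt_q) dist0 ?addn0.
  have lw' : lv w' = offset N t + dist w' q.
    by apply/eqP; rewrite eqn_leq (level_le w' rt_q) //= -lq; lia.
  have w'q3 := level_lt3 rt_q lw'.
  have wq : dist w q <= 3 * rad t.
    by have := dist_tri Yconn w w' q; rewrite (adj_dist Yconn ww'); lia.
  have t_le := rad_le N t.
  have uqt : dist u q + rad t + 5 <= R by lia.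
  have isoq := piso_sub Yconn Yconn isof (w := q) (R' := rad t) (ltac:(lia)).
  have isoq' := piso_sub Yconn Yconn isof' (w := q) (R' := rad t) (ltac:(lia)).
  have [g [isog _ _]] := piso_sym isoq.
  have dw : dist u w + dist w q <= R by lia.
  apply: (sep t (f q) (f' q) (f' \o g)).
  - by apply: root_fwd tk _ _ _ _ _ isof _ rt_q; lia.
  - by apply: root_fwd tk _ _ _ _ _ isof' _ rt_q; lia.
  - exact: neq.
  - apply: leq_trans (dist_tri Yconn _ (f w) _) _.
    rewrite [dist (f q) _]dist_sym // (piso_dist Yconn Yconn isof) // fw.
    by rewrite (piso_dist Yconn Yconn isof') //; lia.
  - exact: piso_comp isog isoq'.
have uq9 : dist u q + 3 * rad true + 9 <= R by lia.
have agree p : lower N q p -> f p = f' p.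
  move=> [qp lp]; apply: (IHn (lv p)) => //; first by lia.
  by have := dist_adj Yconn w' qp; lia.
have sub g h vg vh : piso kappa kappa u vg R g -> piso kappa kappa u vh R h ->
    (forall p, lower N q p -> g p = h p) -> (lower N (g q) `<=` lower N (h q))%classic.
  move=> isog isoh gh p [gp lp].
  have vgq := piso_dist_center Yconn Yconn isog (a := q) (ltac:(lia)).
  have vp := dist_adj Yconn vg gp; rewrite vgq in vp.
  have [g' [isog' g'g gg']] := piso_sym isog.
  have [ug'p gg'p] := gg' p (ltac:(lia)).
  have ug' : dist u (g' p) <= dist u q + 1.
    by rewrite (piso_dist_center Yconn Yconn isog') //; lia.
  have lgp : lv p = lv (g' p) by rewrite -{1}gg'p (level_inv tk isog) //; lia.
  have lgq : lv (g q) = lv q by apply: (level_inv tk isog); lia.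
  have lowp : lower N q (g' p).
    split; last by rewrite -lgp -lgq.
    by rewrite -(piso_adj isog) ?gg'p //; lia.
  rewrite -gg'p (gh _ lowp); split.
    by rewrite (piso_adj isoh) //; [case: lowp|lia].
  rewrite (level_inv tk isoh); last by lia.
  by rewrite (level_inv tk isoh); [rewrite -lgp -lgq|lia].
have nonroot g vg : piso kappa kappa u vg R g -> ~ is_root N (g q).
  move=> isog [t rtg]; apply: nq; exists t.
  by apply: root_bwd tk _ _ _ _ _ isog _ rtg; lia.
apply: (chi_determined (Yconn := Yconn) (Yinf := Yinf) (nonroot _ _ isof) (nonroot _ _ isof')).
- apply/seteqP; split; [apply: sub isof isof' _|apply: sub isof' isof _] => // p /agree //.
- by rewrite (chi_inv tk isof) ?(chi_inv tk isof') //; lia.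
Qed.

Lemma beacons_dense p : exists2 s, beacons s & dist s p <= 3 * rad true + 6.
Proof.
have [t [r rtr e]] := level_attained N p.
exists (beacon Yconn Yinf t r); first by exists t; exists r.
have := dist_tri Yconn (beacon Yconn Yinf t r) r p.
rewrite [dist _ r]dist_sym // dist_beacon [dist r p]dist_sym //.
by have := level_lt3 rtr e; have := rad_le N t; lia.
Qed.

Lemma beacon_root_at s : beacons s -> root_at N s 6.
Proof.
by move=> [t [r [rtr ->]]]; exists t; exists r; rewrite dist_sym // dist_beacon.
Qed.

Lemma zero_at6_beacon kappa v : tinted kappa -> kappa v = 0 -> root_at N v 6 -> beacons v.
Proof.
move=> tk kv [t [r [rtr vr]]].
have [t' [r' [rtr' sv]]] := tinted_site tk kv.
have [] := near_unique Yconn rtr' rtr (site_dist sv); first by rewrite dist_sym // vr; lia.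
move=> ? ?; subst r' t'; rewrite dist_sym // in vr.
have md34 : 3 <= marker_dist t <= 4 by rewrite /marker_dist; case: (t).
case: sv => [ev|]; first by rewrite ev dist0 in vr.
case=> [ev|ev|ev|/dist_slot]; last by rewrite vr.
- by rewrite ev dist_flag in vr.
- by rewrite ev dist_marker in vr; lia.
- by exists t; exists r.
Qed.

Lemma slot_root_at s : slots s -> ~ root_at N s 6.
Proof.
move=> [t [r [rtr ss]]] [t' [r' [rtr' sr']]].
have /andP[s10 srad] := dist_slot ss.
have [] := near_unique Yconn rtr rtr' srad; first by rewrite dist_sym // sr'; lia.
by move=> e _; rewrite e dist_sym // sr' in s10.
Qed.

(** The beacons are the only zeros at distance exactly 6 from a root, so their
    bits can be erased canonically. *)
Lemma recover_slots y x u v R f :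
  piso (zero_on (zero_on chi slots y) beacons x) (zero_on (zero_on chi slots y) beacons x)
    u v (R + (7 * rad true + 30)) f ->
  piso (zero_on chi slots y) (zero_on chi slots y) u v R f.
Proof.
set kappa := zero_on (zero_on chi slots y) beacons x => isof.
have tint1 : tinted (zero_on chi slots y).
  exact: tinted_zero_on (@slots_toggle _ _ _ _ _) (tinted_chi _ _ _).
have tk : tinted kappa by apply: tinted_zero_on (@beacons_toggle _ _ _ _ _) tint1.
have formula w : zero_on chi slots y w =
    if (kappa w == 0) && `[< root_at N w 6 >] then 1 else kappa w.
  case: eqP => [kw|kw] /=; last first.
    by move: kw; rewrite /kappa /zero_on; case: ifP.
  case: asboolP => [w6|nw6].
    have bw := zero_at6_beacon tk kw w6; rewrite /zero_on asboolF /=.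
      by apply: toggle_chi; apply: beacons_toggle.
    by move=> /slot_root_at.
  move: kw; rewrite {1 2}/kappa /zero_on [asbool (beacons w)]asboolF //.
  by move=> /beacon_root_at.
have := piso_sub Yconn Yconn isof (w := u) (R' := R); rewrite dist0 (piso_center isof).
move=> /(_ (leq_addr _ _)) isoR; apply: (piso_recolor isoR) => a ua.
rewrite !formula (piso_color isoR) //; congr (if _ && _ then _ else _).
have iff6 := root_at_iff tk isof (w := a) (n := 6) (ltac:(lia)).
by apply/asboolP/asboolP => /iff6.
Qed.

End RigidColoring.

Theorem locally_distinguishing_coloring (Y : ggraph) (Delta : nat) :
  connected_graph Y -> (forall u : Y, degree u <= Delta) ->
  infinite_set [set: Y]%classic ->
  exists psi : Y -> nat, (forall v, psi v < Delta) /\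
    forall D, exists R, forall u v, u <> v -> dist u v <= D -> forall f,
      ~ piso psi psi u v R f.
Proof.
move=> Yconn Ydeg Yinf; have [N] := nets_exist Delta Yconn.
have [y sep] := slot_bits_separate Yconn Ydeg Yinf N.
set phi := zero_on _ _ y in sep.
have tint1 : tinted Yconn Yinf N phi.
  exact: tinted_zero_on (@slots_toggle _ _ _ _ _) (tinted_chi _ _ _).
have [|x xP] := toggles_break_displacements Yconn Ydeg Yinf
  (separates_rigid tint1 sep) _ (@beacons_dense _ _ Yconn Yinf N)
  (@recover_slots _ _ Yconn Yinf N y).
  move=> s bs; have bt := beacons_toggle bs.
  rewrite /phi /zero_on asboolF ?(toggle_chi bt) // => /slot_root_at.
  by apply; apply: beacon_root_at bs.
have Delta_gt0 : 0 < Delta by apply: ltnW (two_le_max_degree Yconn Ydeg Yinf).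
have zero_on_lt (kappa : Y -> nat) X z : (forall v, kappa v < Delta) ->
    forall v, zero_on kappa X z v < Delta.
  by move=> kl v; rewrite /zero_on; case: ifP.
exists (zero_on phi (beacons Yconn Yinf N) x); split=> //.
exact/zero_on_lt/zero_on_lt/chi_lt.
Qed.

(** * Limits and repetitivity *)

Section Automorphisms.
Variables (Z : ggraph) (T : Type) (psi : Z -> T).
Hypothesis Zconn : connected_graph Z.

Lemma graph_iso_dist_le (F : Z -> Z) u v : graph_iso F -> dist (F u) (F v) <= dist u v.
Proof.
move=> [bijF ue de]; apply: dist_min => //.
have [s [ps <- <-]] := dist_walk Zconn u v; exists (map F s).
rewrite last_map size_map path_map; split=> //.
apply: sub_path ps => x y; rewrite /= /adj !ue !de => /andP[nxy ->]; rewrite andbT.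
by rewrite (inj_eq (bij_inj bijF)).
Qed.

Lemma graph_iso_piso (F : Z -> Z) u R : graph_iso F ->
  (forall v, psi (F v) = psi v) -> piso psi psi u (F u) R F.
Proof.
move=> isoF col; split=> //; have [[G FG GF] ue de] := isoF.
have isoG : graph_iso G.
  by split=> [|a b|a b]; [exists F|rewrite -ue !GF|rewrite -de !GF].
exists G; split=> [a ua|b ub|//|//].
  by split=> //; apply: leq_trans ua; apply: graph_iso_dist_le.
by split=> //; apply: leq_trans ub; rewrite -{1}(FG u); apply: graph_iso_dist_le.
Qed.

End Automorphisms.

Section Colorings.
Variables (Y : ggraph) (n : nat).
Hypothesis Yconn : connected_graph Y.
Implicit Types (phi chi xi : Y -> 'I_n).

(** If an automorphism F of a limit moves z0, pull the disks of radius R around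
    z0 and F z0 back to Y: they sit at distinct vertices u and v at distance
    dist z0 (F z0), and F provides an isomorphism between them. *)
Lemma locally_distinguishing_limit_aperiodic phi :
  (forall D, exists R, forall u v, u <> v -> dist u v <= D ->
     forall f, ~ piso phi phi u v R f) ->
  limit_aperiodic phi.
Proof.
move=> dst Z psi z Zconn lim F isoF colF z0; apply: contrapT => moved.
have [R RP] := dst (dist z0 (F z0)).
set D := dist z0 (F z0) in RP.
pose L := dist z z0 + D + R + 1.
have [y /colored_disk_equivP[h isoh]] := lim L (ltac:(rewrite /L; lia)).
have [k [isok _ _]] := piso_sym isoh.
have zF : dist z (F z0) <= dist z z0 + D by apply: dist_tri.
have k0 := piso_sub Zconn Yconn isok (w := z0) (R' := R) (ltac:(rewrite /L; lia)).
have k1 := piso_sub Zconn Yconn isok (w := F z0) (R' := R) (ltac:(rewrite /L; lia)).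
have [h0 [isoh0 _ _]] := piso_sym k0.
have F0 := graph_iso_piso Zconn z0 R isoF colF.
apply: (RP (k z0) (k (F z0)) _ _ _ (piso_comp (piso_comp isoh0 F0) k1)).
  move=> /(piso_inj isok) e; apply: moved; apply/esym/e; rewrite /L; lia.
by rewrite (piso_dist Zconn Yconn isok) // /L; lia.
Qed.

(** Every finite pattern of chi is a pattern of phi; equivalently, chi is a
    limit of phi for every base point. *)
Definition occurs_in chi phi := forall y R, exists y' f, piso chi phi y y' R f.

Lemma occurs_in_refl phi : occurs_in phi phi.
Proof. by move=> y R; exists y; exists id; apply: piso_id. Qed.

Lemma occurs_in_trans phi chi xi : occurs_in xi chi -> occurs_in chi phi -> occurs_in xi phi.
Proof.
move=> xc cp y R; have [y' [f isof]] := xc y R; have [y'' [g isog]] := cp y' R.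
by exists y''; exists (g \o f); apply: piso_comp isof isog.
Qed.

Lemma occurs_in_limit_aperiodic chi phi : occurs_in chi phi ->
  limit_aperiodic phi -> limit_aperiodic chi.
Proof.
move=> occ lim Z psi z Zconn limchi; apply: (lim Z psi z Zconn) => R R0.
have [y /colored_disk_equivP[f isof]] := limchi R R0.
have [y' [g isog]] := occ y R; have [g' [isog' _ _]] := piso_sym isog.
by exists y'; apply/colored_disk_equivP; exists (f \o g'); apply: piso_comp isog' isof.
Qed.

(** A chain of colorings has a lower bound by [compactness], applied to the
    filter of its tails. *)
Lemma minimal_coloring phi : exists2 chi, occurs_in chi phi &
  forall xi, occurs_in xi chi -> occurs_in chi xi.
Proof.
pose T := {chi : Y -> 'I_n | `[< occurs_in chi phi >]}.
pose le (a b : T) := `[< occurs_in (val b) (val a) >].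
have t0P : `[< occurs_in phi phi >] by apply/asboolP/occurs_in_refl.
have [|||a minA] := @ZL_preorder T (exist _ phi t0P) le.
- by move=> a; apply/asboolP/occurs_in_refl.
- by move=> b a c /asboolP ba /asboolP cb; apply/asboolP; apply: occurs_in_trans cb ba.
- move=> A totA; have [[a0 Aa0]|A0] := pselect (exists a, A a); last first.
    by exists (exist _ phi t0P) => a Aa; case: A0; exists a.
  pose F : set_system T := filter_from A (fun a => [set b | A b /\ le a b]%classic).
  have PF : ProperFilter F.
    apply: filter_from_proper => [|a Aa]; last first.
      by exists a; split=> //; apply/asboolP/occurs_in_refl.
    apply: filter_from_filter; first by exists a0.
    have mono a b : le a b -> ([set c | A c /\ le b c] `<=` [set c | A c /\ le a c])%classic.
      move=> /asboolP ab c [Ac /asboolP bc]; split=> //.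
      by apply/asboolP; apply: occurs_in_trans bc ab.
    move=> a b Aa Ab; have [/mono ab|/mono ba] := totA a b Aa Ab.
      by exists b => // c bc; split=> //; apply: ab.
    by exists a => // c ac; split=> //; apply: ba.
  have [h hP] := compactness (fun a : T => val a) PF.
  have occ a : A a -> occurs_in h (val a).
    move=> Aa y R; have [|b [Ab /asboolP ab] eqb] :=
        hP (enum_fset (ball y R)) [set b | A b /\ le a b]%classic.
      by exists a.
    have [y' [f isof]] := ab y R; exists y'; exists f.
    apply: (piso_recolor isof) => x yx; rewrite (piso_color isof) // eqb //.
    by rewrite [_ \in _](in_ball Yconn).
  have hphi : `[< occurs_in h phi >].
    by apply/asboolP; apply: occurs_in_trans (occ a0 Aa0) _; apply/asboolP; apply: (valP a0).
  by exists (exist _ h hphi) => a Aa; apply/asboolP; apply: occ.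
exists (val a); first exact/asboolP/(valP a).
move=> xi xa; have xphi : `[< occurs_in xi phi >].
  by apply/asboolP; apply: occurs_in_trans xa _; apply/asboolP; apply: (valP a).
by have /asboolP := minA (exist _ xi xphi) (introT (asboolP _) xa).
Qed.

(** Suppose that the R-disk of chi at p is missing from arbitrarily large disks.
    Since Y is repetitive, among these there are copies, without colors, of the
    k-disks at p.  Transporting chi to the k-disks at p and letting k go to
    infinity gives xi below chi without that pattern, against minimality. *)
Lemma minimal_repetitive chi : repetitive Y ->
  (forall xi, occurs_in xi chi -> occurs_in chi xi) -> repetitive_coloring chi.
Proof.
move=> [p [r [[r_mono r_oo] _ r_dense]]] minchi.
exists p; exists S; split=> //; first by split=> // M; exists M.
move=> i; set R := i.+1; apply: contrapT => sparse.
have /choice [ga gaP] k : exists ga : (Y -> Y) * Y,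
    piso (fun=> tt) (fun=> tt) p ga.2 k ga.1 /\
    forall y f, dist ga.2 y <= k -> ~ piso chi chi y p R f.
  have [j le_k] := r_oo k; have [C CP] := r_dense j.
  have [v vP] : exists v, forall a, colored_disk_equiv chi chi a p R -> C + k < dist v a.
    apply: contrapT => nv; apply: sparse; exists (C + k) => v.
    apply: contrapT => na; apply: nv; exists v => a aP; rewrite ltnNge; apply/negP => le_a.
    by apply: na; exists a.
  have [a /disk_equivP[f isof] va] := CP v.
  have [g [isog _ _]] := piso_sym isof.
  have := piso_sub Yconn Yconn isog (w := p) (R' := k); rewrite dist0 add0n (piso_center isog).
  move=> /(_ le_k) isogk; exists (g, a); split=> //= y f' ay isof'.
  have := vP y (iffRL (colored_disk_equivP _ _ _ _ _) (ex_intro _ f' isof')).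
  by have := dist_tri Yconn v a y; lia.
pose F : set_system nat := filter_from setT (fun N => [set k | N <= k]%classic).
have PF : ProperFilter F.
  by apply: filter_from_proper => N _; exists N => /=.
have [xi xiP] := compactness (fun k => chi \o (ga k).1) PF.
have copy y R' : exists k, piso xi chi y ((ga k).1 y) R' (ga k).1 /\ dist p y <= k.
  have [|k /= le_k eqk] := xiP (enum_fset (ball y R')) [set k | dist p y + R' <= k]%classic.
    by exists (dist p y + R').
  have [isok _] := gaP k; exists k; split; last by lia.
  have := piso_sub Yconn Yconn isok le_k => isoy; apply: (piso_recolor isoy) => x yx.
  by rewrite -eqk // [_ \in _](in_ball Yconn).
have [|y [f isof]] := minchi xi _ p R.
  by move=> y R'; have [k [isok _]] := copy y R'; exists ((ga k).1 y); exists (ga k).1.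
have [k [isok pk]] := copy y R.
have [f' [isof' _ _]] := piso_sym isof; have [h [isoh _ _]] := piso_sym isok.
have [isop nop] := gaP k.
apply: (nop ((ga k).1 y) (f' \o h)); last exact: piso_comp isoh isof'.
by rewrite (piso_dist_center Yconn Yconn isop).
Qed.

End Colorings.

Theorem corollary1p6 (Y : ggraph)
  (Yinf : infinite_set [set: Y]%classic) (Yconn : connected_graph Y) :
  (D_L Y <= max_degree Y)%E /\
  (repetitive Y -> (D_RL Y <= max_degree Y)%E).
Proof.
have [[B Bdeg]|unb] := pselect (exists B, forall u : Y, degree u <= B); last first.
  suff -> : max_degree Y = +oo%E by rewrite !leey.
  apply: nat_sup_unbounded => m; apply: contrapT => nm; apply: unb; exists m => u.
  by rewrite leqNgt; apply/negP => lt_m; apply: nm; exists (degree u); [exists u|apply: ltnW].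
have [u0 _] : exists u0 : Y, True.
  apply: contrapT => nex; apply: Yinf; rewrite (_ : setT = set0) // -subset0 => v _.
  by case: nex; exists v.
have exD : exists d, `[< exists u : Y, degree u = d >].
  by exists (degree u0); apply/asboolP; exists u0.
have leB d : `[< exists u : Y, degree u = d >] -> d <= B by move=> /asboolP[u <-].
have [Delta /asboolP[u uD] Ddeg] := ex_maxnP exD leB.
have Ydeg (v : Y) : degree v <= Delta by apply: Ddeg; apply/asboolP; exists v.
have -> : max_degree Y = Delta%:Z%:E%E.
  by apply: nat_sup_max => [|m [v _ <-]//]; exists u.
have [psi [psi_lt psiP]] := locally_distinguishing_coloring Yconn Ydeg Yinf.
pose phi (v : Y) : 'I_Delta := Ordinal (psi_lt v).
have lim : limit_aperiodic phi.
  apply: locally_distinguishing_limit_aperiodic => // D.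
  have [R RP] := psiP D; exists R => v w neq le_D f isof.
  apply: (RP v w neq le_D f); apply: (piso_recolor isof) => a va.
  by have /(congr1 val) := piso_color isof va.
have Delta0 : 0 < Delta by apply: leq_ltn_trans (psi_lt u0).
split=> [|rep]; apply: nat_inf_le; split=> //; first by exists phi.
have [chi occ minchi] := minimal_coloring Yconn phi.
exists chi; split; first exact: minimal_repetitive.
exact: occurs_in_limit_aperiodic occ lim.
Qed.
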